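(* Let $a<b$ be real numbers, $I=[a,b]$, $0\le\alpha<1$, $\beta>0$, and let $w\in C^1([a,b])$ with $w>0$ and $w'>0$ on $[a,b]$. Let $L\in C^1(I\times\mathbb{R}\times\mathbb{R}\times\mathbb{R}\to\mathbb{R})$ and $X_a,X_b\in\mathbb{R}$. If $X\in AC([a,b]\to\mathbb{R})$ is a minimizer of $$ J[X]=\int_a^b L\left(t,X(t),{}^{R}_{a,w}D^{\alpha,\beta}X(t),{}^{R}D^{\alpha,\beta}_{b,w}X(t)\right)dt $$ subject to the boundary conditions $X(a)=X_a$, $X(b)=X_b$, then $X$ satisfies the weighted generalized fractional Euler--Lagrange equation $$ \partial_2L+w(t)^2\;{}^{R}D^{\alpha,\beta}_{b,w}\left(\frac{\partial_3L}{w(t)^2}\right)+w(t)^2\;{}^{R}_{a,w}D^{\alpha,\beta}\left(\frac{\partial_4L}{w(t)^2}\right)=0, $$ where $\partial_iL$ denotes the partial derivative of $L$ with respect to its $i$th argument, evaluated at $\left(t,X(t),{}^{R}_{a,w}D^{\alpha,\beta}X(t),{}^{R}D^{\alpha,\beta}_{b,w}X(t)\right)$.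
   Context: $B$ is a normalization function with $B(0)=B(1)=1$ and $B(\alpha)\neq 0$. Put $\phi(\alpha)=\frac{1-\alpha}{B(\alpha)}$ and $\mu_\alpha=\frac{\alpha}{1-\alpha}$. The Mittag--Leffler function is $E_\beta(z)=\sum_{j=0}^\infty \frac{z^j}{\Gamma(\beta j+1)}$, $z\in\mathbb{C}$. The left- and right-weighted generalized fractional derivatives (in the Riemann--Liouville sense) are $$ {}^{R}_{a,w}D^{\alpha,\beta}f(x)=\frac{1}{\phi(\alpha)}\frac{1}{w(x)}\frac{d}{dx}\int_a^x w(s)f(s)\,E_\beta\!\left[-\mu_\alpha(x-s)^\beta\right]ds, $$ $$ {}^{R}D^{\alpha,\beta}_{b,w}f(x)=\frac{-1}{\phi(\alpha)}\frac{1}{w(x)}\frac{d}{dx}\int_x^b w(s)f(s)\,E_\beta\!\left[-\mu_\alpha(s-x)^\beta\right]ds. $$ $AC(I\to\mathbb{R})$ denotes the set of absolutely continuous functions $X:I\to\mathbb{R}$ whose left- and right-weighted generalized fractional derivatives exist, endowed with the norm $\|X\|=\sup_{t\in I}\left(|X(t)|+|{}^{R}_{a,w}D^{\alpha,\beta}X(t)|+|{}^{R}D^{\alpha,\beta}_{b,w}X(t)|\right)$. A minimizer is an element of $AC([a,b]\to\mathbb{R})$ satisfying the boundary conditions at which $J$ attains its minimum among all such elements. *)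

(* Defs.v *)
From HB Require Import structures.
From mathcomp Require Import all_boot all_order all_algebra.
From mathcomp Require Import all_classical all_reals all_analysis.

Set Implicit Arguments.
Unset Strict Implicit.
Unset Printing Implicit Defensive.

Import Order.TTheory GRing.Theory Num.Theory.
Import numFieldNormedType.Exports.

Local Open Scope classical_set_scope.
Local Open Scope ring_scope.

(* Derivatives are taken relative to a set A: for A = `[a, b] they are two-sided
   at interior points and one-sided at a and b, so that they depend only on the
   values of f on `[a, b].  [deriv_in] is meaningful only where
   [derivable_in] holds. *)
Definition diff_quot (R : realType) (f : R -> R) (x y : R) : R :=
  (f y - f x) / (y - x).

Definition derivable_in (R : realType) (A : set R) (f : R -> R) (x : R) : Prop :=
  cvg (diff_quot f x y @[y --> within A x^']).

Definition deriv_in (R : realType) (A : set R) (f : R -> R) (x : R) : R :=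
  lim (diff_quot f x y @[y --> within A x^']).

Definition C1_in (R : realType) (A : set R) (f : R -> R) : Prop :=
  (forall x, A x -> derivable_in A f x) /\ {within A, continuous (deriv_in A f)}.

Definition Gamma (R : realType) (x : R) : R :=
  \int[@lebesgue_measure R]_(t in `]0, +oo[) (t `^ (x - 1) * expR (- t)).

(* The fractional operators evaluate the Mittag-Leffler function at real
   arguments only, hence the restriction to real z. *)
Definition mittag_leffler (R : realType) (beta z : R) : R :=
  limn (series (fun j : nat => z ^+ j / Gamma (beta * j%:R + 1))).

Definition frac_phi (R : realType) (B : R -> R) (alpha : R) : R :=
  (1 - alpha) / B alpha.

Definition frac_mu (R : realType) (alpha : R) : R := alpha / (1 - alpha).

(* u is x - s or s - x, nonnegative on the range of integration;
   [0 `^ beta = 0] as beta > 0. *)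
Definition frac_kernel (R : realType) (alpha beta u : R) : R :=
  mittag_leffler beta (- frac_mu alpha * u `^ beta).

Definition wint_left (R : realType) (a alpha beta : R) (w f : R -> R) (x : R) : R :=
  \int[@lebesgue_measure R]_(s in `[a, x])
    (w s * f s * frac_kernel alpha beta (x - s)).

Definition wint_right (R : realType) (b alpha beta : R) (w f : R -> R) (x : R) : R :=
  \int[@lebesgue_measure R]_(s in `[x, b])
    (w s * f s * frac_kernel alpha beta (s - x)).

(* Both endpoints are parameters of both operators, because the outer d/dx is
   taken relative to `[a, b]. *)
Definition wRD_left_exists (R : realType) (a b alpha beta : R)
    (w f : R -> R) (x : R) : Prop :=
  derivable_in `[a, b] (wint_left a alpha beta w f) x.

Definition wRD_left (R : realType) (a b : R) (B : R -> R) (alpha beta : R)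
    (w f : R -> R) (x : R) : R :=
  1 / frac_phi B alpha * (1 / w x) *
    deriv_in `[a, b] (wint_left a alpha beta w f) x.

Definition wRD_right_exists (R : realType) (a b alpha beta : R)
    (w f : R -> R) (x : R) : Prop :=
  derivable_in `[a, b] (wint_right b alpha beta w f) x.

Definition wRD_right (R : realType) (a b : R) (B : R -> R) (alpha beta : R)
    (w f : R -> R) (x : R) : R :=
  - 1 / frac_phi B alpha * (1 / w x) *
    deriv_in `[a, b] (wint_right b alpha beta w f) x.

Definition abs_continuous (R : realType) (a b : R) (f : R -> R) : Prop :=
  forall e : R, 0 < e -> exists2 d : R, 0 < d &
    forall (n : nat) (u v : 'I_n -> R),
      (forall i, [/\ a <= u i, u i <= v i & v i <= b]) ->
      trivIset setT (fun i => [set` `]u i, v i[ ]) ->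
      \sum_(i < n) (v i - u i) < d ->
      \sum_(i < n) `|f (v i) - f (u i)| < e.

Definition frac_AC (R : realType) (a b alpha beta : R) (w X : R -> R) : Prop :=
  abs_continuous a b X /\
  forall t, t \in `[a, b] ->
    wRD_left_exists a b alpha beta w X t /\ wRD_right_exists a b alpha beta w X t.

Definition partial1 (R : realType) (a b : R) (L : R -> R -> R -> R -> R)
    (t x y z : R) : R := deriv_in `[a, b] (fun s => L s x y z) t.

Definition partial2 (R : realType) (L : R -> R -> R -> R -> R)
    (t x y z : R) : R := derive1 (fun s => L t s y z) x.

Definition partial3 (R : realType) (L : R -> R -> R -> R -> R)
    (t x y z : R) : R := derive1 (fun s => L t x s z) y.

Definition partial4 (R : realType) (L : R -> R -> R -> R -> R)
    (t x y z : R) : R := derive1 (fun s => L t x y s) z.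

Definition continuous_slab (R : realType) (a b : R)
    (F : R -> R -> R -> R -> R) : Prop :=
  {within [set p : R * R * R * R | p.1.1.1 \in `[a, b]],
    continuous (fun p : R * R * R * R => F p.1.1.1 p.1.1.2 p.1.2 p.2)}.

Definition C1_slab (R : realType) (a b : R) (L : R -> R -> R -> R -> R) : Prop :=
  (forall t x y z, t \in `[a, b] ->
    [/\ derivable_in `[a, b] (fun s => L s x y z) t,
        derivable (fun s => L t s y z) x 1,
        derivable (fun s => L t x s z) y 1 &
        derivable (fun s => L t x y s) z 1]) /\
  [/\ continuous_slab a b (partial1 a b L), continuous_slab a b (partial2 L),
      continuous_slab a b (partial3 L) & continuous_slab a b (partial4 L)].

(* F at (t, X(t), left derivative of X at t, right derivative of X at t) *)
Definition along (R : realType) (a b : R) (B : R -> R) (alpha beta : R)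
    (w : R -> R) (F : R -> R -> R -> R -> R) (X : R -> R) (t : R) : R :=
  F t (X t) (wRD_left a b B alpha beta w X t) (wRD_right a b B alpha beta w X t).

Definition frac_J (R : realType) (a b : R) (B : R -> R) (alpha beta : R)
    (w : R -> R) (L : R -> R -> R -> R -> R) (X : R -> R) : R :=
  \int[@lebesgue_measure R]_(t in `[a, b]) along a b B alpha beta w L X t.

Definition admissible (R : realType) (a b alpha beta : R) (w : R -> R)
    (Xa Xb : R) (X : R -> R) : Prop :=
  [/\ frac_AC a b alpha beta w X, X a = Xa & X b = Xb].

Definition minimizer (R : realType) (a b : R) (B : R -> R) (alpha beta : R)
    (w : R -> R) (L : R -> R -> R -> R -> R) (Xa Xb : R) (X : R -> R) : Prop :=
  admissible a b alpha beta w Xa Xb X /\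
  forall Y, admissible a b alpha beta w Xa Xb Y ->
    frac_J a b B alpha beta w L X <= frac_J a b B alpha beta w L Y.

(* Main.v *)
Require Import Defs.
From mathcomp Require Import all_boot all_order all_algebra.
From mathcomp Require Import all_classical all_reals all_analysis.
From mathcomp Require Import measurable_realfun ring lra.
Import Order.TTheory GRing.Theory Num.Theory.
Import numFieldNormedType.Exports.
Local Open Scope classical_set_scope.
Local Open Scope ring_scope.
Set Implicit Arguments.
Unset Strict Implicit.
Unset Printing Implicit Defensive.

(** The operators differentiate a convolution of [w * f] with the kernel
[k u = E_beta (- mu * u ^ beta)]. This kernel is continuous of bounded variation,
but for [beta < 1] and [alpha] nonzero it is not Lipschitz at 0, so the convolution cannot be
differentiated under the integral sign. Still, with [k = k 0 + q],
  d/dx of the integral of [H s * k (x - s)] over `[a, x]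
    = k 0 * H x + integral of [H s] against [dq (x - s)],
and the right-hand side makes sense and is continuous as soon as [H] is. Step
functions [H], for which everything is explicit, approximate continuous ones
well enough to prove this, together with the adjunction between [q] and its
reflection ([convol_step], [convol_approx], [dconvol_adjoint]). That [q] has
bounded variation comes from comparing its power series with the series of
absolute values, which converges because [Gamma] grows faster than any
exponential ([Gamma_inv_le], [mittag_leffler_variation]).

Two facts follow for functions continuous on `[a, b]: their left and right
fractional derivatives exist everywhere, endpoints included, and are continuous
([wRD_left_spec], [wRD_right_spec]); and the two operators are adjoint with
respect to the weight [w ^ 2], without boundary terms ([wRD_adjoint]). In
particular the partial derivatives of [L] along the minimizer are continuous,
and the derivatives required in the Euler-Lagrange equation exist with no
further regularity of [X].

The rest is the classical argument. For [h] Lipschitz and zero at both ends,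
[X + c * h] is admissible, so the first variation of the energy vanishes
([first_variation]). By adjunction it is the integral of [h] times the left-hand
side of the equation, which is continuous, hence zero ([fundamental_lemma]). *)

(** * Derivatives and integrals of continuous functions *)

Section epsilon_delta.
Context {R : realType}.
Implicit Types f g : R -> R.

Lemma divD1_mulr_lt (e N : R) : 0 < e -> 0 <= N -> e / (N + 1) * N < e.
Proof.
move=> e0 N0; have N1 : 0 < N + 1 by rewrite ltr_wpDl.
by rewrite mulrAC ltr_pdivrMr// ltr_pM2l// ltrDl.
Qed.

Lemma continuous_atP f (x : R) : {for x, continuous f} <->
  forall e, 0 < e -> exists2 d, 0 < d & forall y, `|y - x| < d -> `|f y - f x| < e.
Proof.
split.
  move=> /cvgrPdist_lt fx e e0; have := fx _ e0.
  move=> /nbhs_ballP[d /= d0 dP]; exists d => // y yx.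
  by rewrite distrC; apply: dP; rewrite /ball/= distrC.
move=> H; apply/cvgrPdist_lt => e e0; have [d d0 dP] := H _ e0.
apply/nbhs_ballP; exists d => // y; rewrite /ball/= => xy.
by rewrite distrC; apply: dP; rewrite distrC.
Qed.

Lemma is_derive_epsP f (x l : R) : is_derive x 1 f l <->
  forall e, 0 < e -> exists2 d, 0 < d &
    forall y, `|y - x| < d -> `|f y - f x - l * (y - x)| <= e * `|y - x|.
Proof.
split.
  move=> [fx <-] e e0; move: fx => /cvgrPdist_le /(_ _ e0) /nbhs_ballP[d /= d0 dP].
  exists d => // y yx; have [->|yx0] := eqVneq y x.
    by rewrite !subrr mulr0 subrr !normr0 mulr0.
  have yx1 : y - x != 0 by rewrite subr_eq0.
  have := dP (y - x); rewrite /ball/= sub0r normrN => /(_ yx yx1).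
  rewrite -[_%:A]/(_ * 1) mulr1 subrK => H.
  have -> : f y - f x - 'D_1 f x * (y - x) =
     - (('D_1 f x - (y - x)^-1 *: (f y - f x)) * (y - x)).
    by rewrite -[_ *: _]/(_ * _); field.
  by rewrite normrN normrM ler_wpM2r.
move=> H.
have cl : (fun h : R => h^-1 *: ((f \o shift x) (h *: 1) - f x)) @ 0^' --> l.
  apply/cvgrPdist_le => e e0; have [d d0 dP] := H _ e0.
  apply/nbhs_ballP; exists d => // h; rewrite /ball/= sub0r normrN => hd h0.
  have := dP (h + x); rewrite addrK => /(_ hd).
  rewrite -[_%:A]/(_ * 1) mulr1 -[_ *: _]/(_ * _) => K.
  rewrite -(@ler_pM2r _ `|h|) ?normr_gt0// -normrM.
  have -> : (l - h^-1 * (f (h + x) - f x)) * h = - (f (h + x) - f x - l * h).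
    by field.
  by rewrite normrN.
by split; [apply/cvg_ex; exists l | exact: cvg_lim].
Qed.

(** The difference quotients of [f] at [x] are Cauchy, being within [e] of those
of a differentiable function for every [e]. The second clause bounds the error
on the derivative by the same [e]: approximants that are uniform in [x] then
give a uniform limit of derivatives. *)
Lemma derivable_of_approx f (x : R) :
  (forall e, 0 < e -> exists2 gl, is_derive x 1 gl.1 gl.2 &
     forall y, `|f y - f x - (gl.1 y - gl.1 x)| <= e * `|y - x|) ->
  exists2 l, is_derive x 1 f l &
    forall e gl, 0 < e -> is_derive x 1 gl.1 gl.2 ->
     (forall y, `|f y - f x - (gl.1 y - gl.1 x)| <= e * `|y - x|) ->
     `|gl.2 - l| <= e.
Proof.
move=> H.
have step e gl : 0 < e -> is_derive x 1 gl.1 gl.2 ->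
  (forall y, `|f y - f x - (gl.1 y - gl.1 x)| <= e * `|y - x|) ->
  forall e', 0 < e' ->
  \forall h \near 0^', `|gl.2 - h^-1 *: ((f \o shift x) (h *: 1) - f x)| <= e + e'.
  case: gl => g l /= e0 /is_derive_epsP gl fg e' e'0.
  have [d d0 dP] := gl _ e'0.
  apply/nbhs_ballP; exists d => // h; rewrite /ball/= sub0r normrN => hd h0.
  have := dP (h + x); rewrite addrK => /(_ hd).
  have := fg (h + x); rewrite addrK.
  rewrite -[_%:A]/(_ * 1) mulr1 -[_ *: _]/(_ * _) => K1 K2.
  rewrite -(@ler_pM2r _ `|h|) ?normr_gt0// -normrM.
  have -> : (l - h^-1 * (f (h + x) - f x)) * h =
    - ((f (h + x) - f x - (g (h + x) - g x)) + (g (h + x) - g x - l * h)).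
    by field.
  by rewrite normrN mulrDl (le_trans (ler_normD _ _))// lerD.
have /cvg_ex[l fl] : cvg ((fun h : R => h^-1 *: ((f \o shift x) (h *: 1) - f x)) @ 0^').
  apply: cauchy_cvg; apply: cauchy_exP => e e0.
  have e3 : 0 < e / 3 by rewrite divr_gt0.
  have [gl d1 d2] := H _ e3; exists gl.2.
  have := step _ _ e3 d1 d2 _ e3; apply: filterS => h /= hh.
  by rewrite /ball /=; lra.
exists l.
  by split; [apply/cvg_ex; exists l | exact: cvg_lim].
move=> e gl e0 d1 d2; apply/ler_addgt0Pr => e' e'0.
have := step _ _ e0 d1 d2 _ e'0.
have : (fun h : R => `|gl.2 - h^-1 *: ((f \o shift x) (h *: 1) - f x)|) @ 0^' --> `|gl.2 - l|.
  by apply: cvg_norm; apply: (cvgB (cvg_cst _) fl).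
move=> c n; rewrite -(cvg_lim (@norm_hausdorff _ _) c).
by apply: limr_le n; exact: cvgP c.
Qed.

End epsilon_delta.

Section continuous_integral.
Context {R : realType}.
Notation mu := (@lebesgue_measure R).
Implicit Types (f g F : R -> R) (c d x : R).

Lemma continuous_integrable f c d : continuous f ->
  mu.-integrable `[c, d] (EFin \o f).
Proof.
move=> cf; apply: continuous_compact_integrable; first exact: segment_compact.
exact: continuous_subspaceT.
Qed.

Lemma is_derive_continuous f (df : R -> R) :
  (forall x : R, is_derive x 1 f (df x)) -> continuous f.
Proof. by move=> fd x; apply: differentiable_continuous; apply/derivable1_diffP; case: (fd x). Qed.

Lemma Rintegral_FTC f F c d : continuous f -> c <= d ->
  (forall x : R, is_derive x 1 F (f x)) ->
  \int[mu]_(x in `[c, d]) f x = F d - F c.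
Proof.
move=> cf cd dF; move: cd; rewrite le_eqVlt => /predU1P[->|cd].
  by rewrite set_itv1 Rintegral_set1 subrr.
have cF := is_derive_continuous dF.
rewrite /Rintegral (@continuous_FTC2 _ f F)//.
- exact: continuous_subspaceT.
- split; first by move=> x _; case: (dF x).
  + by apply: cvg_at_right_filter; exact: cF.
  + by apply: cvg_at_left_filter; exact: cF.
- by move=> x _; rewrite derive1E; case: (dF x).
Qed.

(** A primitive on the whole line reduces additivity and translation of
integrals of continuous functions to identities between increments. *)
Lemma antiderivative f : continuous f ->
  exists F, forall x : R, is_derive x 1 F (f x).
Proof.
move=> cf.
pose P M y : R := \int[mu]_(t in `[- M, y]) f t.
have split3 (p q r : R) : p <= q -> q <= r ->
  \int[mu]_(t in `[p, r]) f t =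
    \int[mu]_(t in `[p, q]) f t + \int[mu]_(t in `[q, r]) f t.
  move=> pq qr.
  have := @Rintegral_itvB _ f (BLeft p) (BRight r) q (continuous_integrable p r cf).
  rewrite !bnd_simp => /(_ pq qr); rewrite Rintegral_itv_obnd_cbnd.
    by move=> <-; rewrite addrC subrK.
  apply: integrableS (continuous_integrable q r cf) => //.
  exact: subset_itv_oc_cc.
exists (fun y => if 0 <= y then \int[mu]_(t in `[0, y]) f t
                 else - \int[mu]_(t in `[y, 0]) f t) => x.
set F := fun y => _.
(* near [x], the two branches agree with one integral based at [- M], far to
   the left of both 0 and [x] *)
pose M := `|x| + 1.
have M0 : 0 < M by rewrite ltr_wpDl.
have xM : - M < x by rewrite /M opprD; have := lerNnormlW (lexx `|x|); lra.
have FP y : - M < y -> F y = P M y - P M 0.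
  move=> My; rewrite /F /P; case: ifPn => [y0|].
    by rewrite (split3 (- M) 0 y)// ?oppr_le0 ?(ltW M0)// addrC addKr.
  rewrite -ltNge => y0; rewrite (split3 (- M) y 0) ?(ltW My) ?(ltW y0)//.
  by ring.
have [dP eP] : derivable (P M) x 1 /\ derive1 (P M) x = f x.
  apply: (@continuous_FTC1_closed _ f (- M) x (x + 1)) => //.
  - by rewrite ltrDl.
  - exact: continuous_integrable.
  - exact: cf.
have /is_derive_epsP H : is_derive x 1 (P M) (f x).
  by apply: (DeriveDef dP); rewrite -eP derive1E.
apply/is_derive_epsP => e e0; have [r r0 rP] := H _ e0.
exists (Num.min r (x + M)).
  by rewrite lt_min r0 /=; lra.
move=> y; rewrite lt_min => /andP[yr yM].
rewrite !FP//; last by move: yM => /ltr_normlP[]; lra.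
have -> : P M y - P M 0 - (P M x - P M 0) = P M y - P M x by ring.
exact: rP.
Qed.

Lemma Rintegral_split f p q r : continuous f -> p <= q -> q <= r ->
  \int[mu]_(t in `[p, r]) f t =
    \int[mu]_(t in `[p, q]) f t + \int[mu]_(t in `[q, r]) f t.
Proof.
move=> cf pq qr; have [F dF] := antiderivative cf.
rewrite (Rintegral_FTC cf (le_trans pq qr) dF) (Rintegral_FTC cf pq dF).
by rewrite (Rintegral_FTC cf qr dF); ring.
Qed.

Lemma Rintegral_linear f g (k l : R) c d : continuous f -> continuous g ->
  \int[mu]_(x in `[c, d]) (k * f x + l * g x) =
  k * \int[mu]_(x in `[c, d]) f x + l * \int[mu]_(x in `[c, d]) g x.
Proof.
move=> cf cg.
have [ckf clg] : continuous (fun x => k * f x) /\ continuous (fun x => l * g x).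
  by split=> x; apply: cvgM; by [exact: cvg_cst | exact: cf | exact: cg].
by rewrite RintegralD// ?RintegralZl//; exact: continuous_integrable.
Qed.

Lemma Rintegral_mono f g c d : continuous f -> continuous g ->
  (forall x, x \in `[c, d] -> f x <= g x) ->
  \int[mu]_(x in `[c, d]) f x <= \int[mu]_(x in `[c, d]) g x.
Proof.
by move=> cf cg fg; apply: le_Rintegral => //; exact: continuous_integrable.
Qed.

Lemma Rintegral_const (k c d : R) : c <= d ->
  \int[mu]_(x in `[c, d]) k = k * (d - c).
Proof.
move=> cd.
have dF x : is_derive x 1 (fun x : R => k * x) k.
  have : is_derive x 1 (fun x : R => k *: x) (k *: 1) by apply: is_deriveZ.
  by rewrite -[k *: 1]/(k * 1) mulr1.
have ck : continuous (fun _ : R => k) by move=> x; exact: cvg_cst.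
by rewrite (@Rintegral_FTC (fun=> k) (fun x => k * x) c d ck cd dF) mulrBr.
Qed.

Lemma Rintegral_norm_le f g c d : continuous f -> continuous g ->
  (forall x, x \in `[c, d] -> `|f x| <= g x) ->
  `|\int[mu]_(x in `[c, d]) f x| <= \int[mu]_(x in `[c, d]) g x.
Proof.
move=> cf cg fg.
apply: le_trans (Rintegral_mono _ cg fg).
  by apply: le_normr_Rintegral => //; exact: continuous_integrable.
by move=> x; apply: cvg_norm; exact: cf.
Qed.

Lemma Rintegral_eq0_continuous f c d : c < d -> continuous f ->
  (forall x, x \in `[c, d] -> 0 <= f x) ->
  \int[mu]_(x in `[c, d]) f x = 0 -> forall x, x \in `]c, d[ -> f x = 0.
Proof.
move=> cd cf f0 i0 x; rewrite in_itv/= => /andP[cx xd].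
apply/eqP; rewrite eq_le f0 ?in_itv/= ?(ltW cx) ?(ltW xd)// andbT leNgt.
apply/negP => fx.
have /continuous_atP/(_ (f x / 2) (divr_gt0 fx (ltr0Sn _ _)))[r r0 rP] := cf x.
pose y := Num.min d (x + r / 2).
have xy : x < y by rewrite lt_min xd ltrDl divr_gt0.
have yd : y <= d by rewrite ge_min lexx.
have yr : y <= x + r / 2 by rewrite ge_min lexx orbT.
have : 0 < \int[mu]_(t in `[x, y]) f t.
  apply: (@lt_le_trans _ _ (\int[mu]_(t in `[x, y]) (f x / 2))).
    by rewrite Rintegral_const ?(ltW xy)// mulr_gt0 ?divr_gt0// subr_gt0.
  apply: Rintegral_mono => //; first by move=> ?; exact: cvg_cst.
  move=> t; rewrite in_itv/= => /andP[xt ty].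
  have : `|f t - f x| < f x / 2 by apply: rP; rewrite ger0_norm; lra.
  by move=> /ltr_normlP[]; lra.
apply/negP; rewrite -leNgt -i0.
rewrite (@Rintegral_split f c x d) ?(ltW cx) ?(ltW xd)//.
rewrite (@Rintegral_split f x y d) ?(ltW xy)//.
rewrite addrCA lerDl addr_ge0// Rintegral_ge0//= => t;
  rewrite in_itv/= => /andP[? ?]; apply: f0; rewrite in_itv/=; apply/andP; lra.
Qed.

End continuous_integral.

Section compact_segment.
Context {R : realType}.

(** Compactness of a segment in the form of a Lebesgue number: finitely many of
the local tolerances suffice, hence their minimum serves everywhere. *)
Lemma segment_uniform (a b : R) (P : R -> R -> Prop) :
  (forall t, t \in `[a, b] -> exists2 r, 0 < r &
     forall t' r', `|t' - t| < r -> 0 < r' < r -> P r' t') ->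
  exists2 r, 0 < r & forall t, t \in `[a, b] -> P r t.
Proof.
move=> H.
have /compact_near_coveringP/(_ _ (0 : R)^'+ P _) := @segment_compact R a b.
have loc t : [set` `[a, b]] t -> \forall t' \near t & r \near (0 : R)^'+, P r t'.
  move=> abt; have [r r0 rP] := H _ abt.
  exists (ball t r, [set r' | 0 < r' < r]) => /=.
    split; first exact: nbhsx_ballx.
    near=> r'; apply/andP; split; first by near: r'; exact: nbhs_right_gt.
    by near: r'; exact: nbhs_right_lt.
  case=> t' r' [/= tt' r'r]; apply: rP => //.
  by move: tt'; rewrite /ball/= distrC.
move=> /(_ loc) cover.
have : \forall r \near (0 : R)^'+, 0 < r /\ `[a, b] `<=` P r.
  by apply: filterI => //; exact: nbhs_right_gt.
by move=> /filter_ex[r [r0 rP]]; exists r.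
Unshelve. all: by end_near. Qed.

Lemma segment_unif_continuous (a b e : R) (f : R -> R) : continuous f -> 0 < e ->
  exists2 r, 0 < r & forall t, t \in `[a, b] ->
    forall s, `|s - t| < r -> `|f s - f t| < e.
Proof.
move=> cf e0; apply: segment_uniform => t _.
have e2 : 0 < e / 2 by rewrite divr_gt0.
have /continuous_atP/(_ _ e2)[r r0 rP] := cf t.
exists (r / 2); first by rewrite divr_gt0.
move=> t' r' tt' /andP[r'0 r'r] s st'.
have h1 : `|f s - f t| < e / 2.
  apply: rP; rewrite -(subrK t' s) -addrA (le_lt_trans (ler_normD _ _))//.
  by rewrite (splitr r) ltrD// (lt_trans st').
have h2 : `|f t' - f t| < e / 2 by apply: rP; rewrite (lt_trans tt')//; lra.
rewrite -(subrK (f t) (f s)) -addrA (le_lt_trans (ler_normD _ _))//.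
by rewrite (splitr e) ltrD// distrC.
Qed.

End compact_segment.

Section continuity_rules.
Context {R : realType}.

Lemma continuous_shift (f : R -> R) x : continuous f ->
  continuous (fun s => f (x - s)).
Proof.
move=> cf s; apply: (@continuous_comp _ _ _ (fun s => x - s) f); last exact: cf.
by apply: cvgB; [exact: cvg_cst | exact: cvg_id].
Qed.

Lemma continuous_shiftl (f : R -> R) s : continuous f ->
  continuous (fun x => f (x - s)).
Proof.
move=> cf x; apply: (@continuous_comp _ _ _ (fun x => x - s) f); last exact: cf.
by apply: cvgB; [exact: cvg_id | exact: cvg_cst].
Qed.

Lemma continuous_fmul (f g : R -> R) : continuous f -> continuous g ->
  continuous (fun s => f s * g s).
Proof. by move=> cf cg s; apply: cvgM; [exact: cf | exact: cg]. Qed.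

Lemma continuous_fsub (f g : R -> R) : continuous f -> continuous g ->
  continuous (fun s => f s - g s).
Proof. by move=> cf cg s; apply: cvgB; [exact: cf | exact: cg]. Qed.

Lemma continuous_const (k : R) : continuous (fun _ : R => k).
Proof. by move=> s; exact: cvg_cst. Qed.

Lemma continuous_linear (f g : R -> R) (k l : R) :
  continuous f -> continuous g -> continuous (fun s => k * f s + l * g s).
Proof.
by move=> cf cg s; apply: cvgD; apply: cvgM; by [exact: cvg_cst | exact: cf | exact: cg].
Qed.

Lemma continuous_abs (f : R -> R) : continuous f -> continuous (fun s => `|f s|).
Proof. by move=> cf s; apply: cvg_norm; exact: cf. Qed.

End continuity_rules.

(** * Convolution with a kernel of bounded variation *)

Section stieltjes_convolution.
Context {R : realType}.
Notation mu := (@lebesgue_measure R).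

Definition convol (c d : R) (q H : R -> R) (x : R) : R :=
  \int[mu]_(s in `[c, d]) (H s * q (x - s)).

Variables (q V : R -> R) (C : R).
Hypothesis cq : continuous q.
Hypothesis cV : continuous V.
Hypothesis V0C : forall u, 0 <= V u <= C.
Hypothesis qV : forall u v, v <= u -> `|q u - q v| <= V u - V v.

Lemma convol_const (f F : R -> R) (c d x : R) : continuous f -> c <= d ->
  (forall x : R, is_derive x 1 F (f x)) ->
  \int[mu]_(s in `[c, d]) f (x - s) = F (x - c) - F (x - d).
Proof.
move=> cf cd dF.
have dF2 (s : R) : is_derive s 1 (fun s => - F (x - s)) (f (x - s)).
  apply/is_derive_epsP => e e0.
  have /is_derive_epsP/(_ _ e0)[r r0 rP] := dF (x - s).
  exists r => // y yr.
  have E : `|x - y - (x - s)| = `|y - s|.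
    by rewrite -normrN; congr (`|_|); ring.
  have := rP (x - y); rewrite E => /(_ yr); rewrite -normrN => K.
  by apply: le_trans K; rewrite le_eqVlt; apply/orP; left; apply/eqP;
    congr (`|_|); ring.
rewrite (Rintegral_FTC (continuous_shift (x:=x) cf) cd dF2).
by rewrite opprK addrC.
Qed.

(** The integral over [s] telescopes: shifting the argument by [x - y] only
matters over two windows of that length at the ends, where [V] is between 0
and [C]. This is what makes the convolution with a bounded function Lipschitz
although the kernel need not be. *)
Lemma variation_integral_le (c d x y : R) : c <= d -> y <= x ->
  \int[mu]_(s in `[c, d]) (V (x - s) - V (y - s)) <= C * (x - y).
Proof.
move=> cd yx; have [W dW] := antiderivative cV.
have -> : \int[mu]_(s in `[c, d]) (V (x - s) - V (y - s)) =
    (W (x - c) - W (y - c)) - (W (x - d) - W (y - d)).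
  have := @Rintegral_linear _ (fun s => V (x - s)) (fun s => V (y - s)) 1 (-1)
     c d (continuous_shift (x:=x) cV) (continuous_shift (x:=y) cV).
  under eq_Rintegral => s _ do rewrite mul1r mulN1r.
  by move=> ->; rewrite !(convol_const _ cV cd dW); ring.
have inc k : W (x - k) - W (y - k) = \int[mu]_(s in `[y - k, x - k]) V s.
  by rewrite (Rintegral_FTC cV _ dW)// lerD2r.
have up : W (x - c) - W (y - c) <= C * (x - y).
  have -> : x - y = x - c - (y - c) by ring.
  rewrite inc -Rintegral_const ?lerD2r//.
  apply: Rintegral_mono => //; first exact: continuous_const.
  by move=> s _; case/andP: (V0C s).
suff : 0 <= W (x - d) - W (y - d) by lra.
by rewrite inc; apply: Rintegral_ge0 => s _; case/andP: (V0C s).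
Qed.

(** If [H] is the indicator of `[c, d], its convolution is the increment of a
primitive [Q] of [q], with derivative [q (x - c) - q (x - d)]; so a step
function gives a convolution [g] of class C^1, although [q] need not be
differentiable.
When [H] is continuous, a fine subdivision makes the error small in the two
senses that survive passage to the limit: the Lipschitz constant of the
difference, and the adjunction formula. The latter reduces, for an indicator,
to the fundamental theorem of calculus for [Psi]. The subdivision is built by
cutting off one interval of length at most [dl / 2] at a time. *)
Lemma convol_step (lo hi a d e dl : R) (H : R -> R) (n : nat) : continuous H ->
  0 < e -> 0 < dl ->
  (forall s t, t \in `[a, d] -> `|s - t| < dl -> `|H s - H t| <= e) ->
  a <= d -> d - a <= n%:R * (dl / 2) ->
  exists g g' : R -> R, [/\ forall x : R, is_derive x 1 g (g' x), continuous g',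
   (forall x y, y <= x -> `|convol a d q H x - convol a d q H y - (g x - g y)| <=
      e * \int[mu]_(s in `[a, d]) (V (x - s) - V (y - s))) &
   forall P Psi Psi' : R -> R, continuous P -> continuous Psi' ->
     (forall x : R, is_derive x 1 Psi (Psi' x)) ->
     (forall c, Psi c = \int[mu]_(x in `[lo, hi]) (P x * q (x - c))) ->
     `|\int[mu]_(x in `[lo, hi]) (P x * g' x) +
       \int[mu]_(s in `[a, d]) (H s * Psi' s)| <=
     e * \int[mu]_(s in `[a, d]) `|Psi' s|].
Proof.
move=> cH e0 dl0; elim: n d => [|n IH] d unif ad adn.
  have -> : d = a by apply/eqP; rewrite eq_le ad andbT; lra.
  exists (fun=> 0), (fun=> 0); split => //.
  - by move=> x; exact: is_derive_cst.
  - exact: continuous_const.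
  - move=> x y _; rewrite /convol !set_itv1 !Rintegral_set1 mulr0.
    by rewrite !subrr normr0.
  - move=> P Psi Psi' _ _ _ _; rewrite set_itv1 !Rintegral_set1 mulr0 addr0.
    under eq_Rintegral do rewrite mulr0.
    by rewrite /Rintegral integral0 normr0.
pose c := Num.max a (d - dl / 2).
have ac : a <= c by rewrite le_max lexx.
have cd : c <= d by rewrite ge_max ad/=; lra.
have dc : d - c <= dl / 2 by rewrite lerBlDl -lerBlDr le_max lexx orbT.
have cn : c - a <= n%:R * (dl / 2).
  rewrite /c lerBlDr ge_max; apply/andP; split.
    by rewrite lerDr mulr_ge0// divr_ge0// ltW.
  by move: adn; rewrite -addn1 natrD mulrDl mul1r; lra.
have [|g [g' [dg cg' err adj]]] := IH c _ ac cn.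
  move=> s t tac; apply: unif; move: tac; rewrite !in_itv/= => /andP[-> tc]/=.
  exact: le_trans cd.
have [Q dQ] := antiderivative cq.
have Hc s : s \in `[c, d] -> `|H s - H c| <= e.
  rewrite in_itv/= => /andP[cs sd]; apply: unif.
    by rewrite in_itv/= ac cd.
  by rewrite ger0_norm; lra.
exists (fun x => g x + H c * (Q (x - c) - Q (x - d))),
       (fun x => g' x + H c * (q (x - c) - q (x - d))); split.
- move=> x; apply: is_deriveD; apply: is_deriveZ.
  have dQs k : is_derive x 1 (fun x => Q (x - k)) (q (x - k)).
    apply/is_derive_epsP => r r0.
    have /is_derive_epsP/(_ _ r0)[r' r'0 r'P] := dQ (x - k).
    exists r' => // y yr; have := r'P (y - k).
    have -> : y - k - (x - k) = y - x by ring.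
    exact.
  exact: is_deriveB.
- move=> x; apply: cvgD; first exact: cg'.
  apply: cvgM; first exact: cvg_cst.
  by apply: continuous_fsub; exact: continuous_shiftl.
- move=> x y yx.
  have cHq z : continuous (fun s => H s * q (z - s)).
    by apply: continuous_fmul => //; exact: continuous_shift.
  have cqq : continuous (fun s => q (x - s) - q (y - s)).
    by apply: continuous_fsub; apply: continuous_shift.
  have cVV : continuous (fun s => V (x - s) - V (y - s)).
    by apply: continuous_fsub; apply: continuous_shift.
  have cHc : continuous (fun s => H s - H c).
    by apply: continuous_fsub => //; exact: continuous_const.
  rewrite /convol /= (Rintegral_split (cHq x) ac cd) (Rintegral_split (cHq y) ac cd).
  rewrite (Rintegral_split cVV ac cd) [leRHS]mulrDr /=.
  have -> : \int[mu]_(s in `[a, c]) (H s * q (x - s)) +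
     \int[mu]_(s in `[c, d]) (H s * q (x - s)) -
     (\int[mu]_(s in `[a, c]) (H s * q (y - s)) +
     \int[mu]_(s in `[c, d]) (H s * q (y - s))) -
     (g x + H c * (Q (x - c) - Q (x - d)) - (g y + H c * (Q (y - c) - Q (y - d)))) =
     (convol a c q H x - convol a c q H y - (g x - g y)) +
     \int[mu]_(s in `[c, d]) ((H s - H c) * (q (x - s) - q (y - s))).
    rewrite /convol -!(convol_const _ cq cd dQ).
    rewrite [X in _ = _ + X](_ : _ =
      (1 * \int[mu]_(s in `[c, d]) (1 * (H s * q (x - s)) + (-1) * (H s * q (y - s)))) +
      (- H c) * \int[mu]_(s in `[c, d]) (1 * q (x - s) + (-1) * q (y - s))).
      rewrite !Rintegral_linear//; [ring|exact: continuous_shift..].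
    rewrite -Rintegral_linear.
    + by apply: eq_Rintegral => s _; ring.
    + by apply: continuous_linear.
    + by apply: continuous_linear; exact: continuous_shift.
  rewrite (le_trans (ler_normD _ _))// lerD//; first exact: err.
  rewrite -[leRHS]addr0 -(mul0r (\int[mu]_(s in `[c, d]) 0)) -Rintegral_linear//;
    last exact: continuous_const.
  apply: Rintegral_norm_le.
  + exact: continuous_fmul.
  + by apply: continuous_linear => //; exact: continuous_const.
  + move=> s scd; rewrite mul0r addr0 normrM.
    by apply: ler_pM => //; [exact: Hc|apply: qV; rewrite lerD2r].
- move=> P Psi Psi' cP cPsi' dPsi PsiE.
  have cHP : continuous (fun s => H s * Psi' s) by exact: continuous_fmul.
  have caP := continuous_abs cPsi'.
  have cPq z : continuous (fun x => P x * q (x - z)).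
    by apply: continuous_fmul => //; exact: continuous_shiftl.
  rewrite /= (Rintegral_split cHP ac cd) (Rintegral_split caP ac cd) [leRHS]mulrDr /=.
  have -> : \int[mu]_(x in `[lo, hi]) (P x * (g' x + H c * (q (x - c) - q (x - d)))) +
     (\int[mu]_(s in `[a, c]) (H s * Psi' s) + \int[mu]_(s in `[c, d]) (H s * Psi' s)) =
     (\int[mu]_(x in `[lo, hi]) (P x * g' x) + \int[mu]_(s in `[a, c]) (H s * Psi' s)) +
     \int[mu]_(s in `[c, d]) (1 * (H s * Psi' s) + (- H c) * Psi' s).
    rewrite Rintegral_linear// (Rintegral_FTC cPsi' cd dPsi) !PsiE.
    rewrite [X in X + _ = _](_ : _ = \int[mu]_(x in `[lo, hi]) (1 * (P x * g' x) +
       1 * (H c * (P x * q (x - c)) + (- H c) * (P x * q (x - d))))); last first.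
      by apply: eq_Rintegral => s _; ring.
    rewrite !Rintegral_linear//; first by ring.
    + exact: continuous_fmul.
    + exact: continuous_linear.
  rewrite (le_trans (ler_normD _ _))// lerD//; first exact: adj.
  rewrite -[leRHS]addr0 -(mul0r (\int[mu]_(s in `[c, d]) 0)) -Rintegral_linear//;
    last exact: continuous_const.
  apply: Rintegral_norm_le.
  + exact: continuous_linear.
  + by apply: continuous_linear => //; exact: continuous_const.
  + move=> s scd; rewrite mul0r addr0 mul1r -mulrDl normrM.
    by apply: ler_pM => //; exact: Hc.
Qed.

End stieltjes_convolution.

Section convolution_derivative.
Context {R : realType}.
Notation mu := (@lebesgue_measure R).

(** Bounded variation, in the form in which it enters the estimates: increments
of [q] are dominated by those of [V]. The kernel of the fractional operators
behaves at 0 like [1 - c * u ^ beta], so for [beta < 1] a Lipschitz bound is not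
available. *)
Definition tame_kernel (q : R -> R) : Prop :=
  continuous q /\ exists (V : R -> R) (C : R), [/\ continuous V, forall u, 0 <= V u <= C &
    forall u v, v <= u -> `|q u - q v| <= V u - V v].

Lemma tame_kernelN (q : R -> R) : tame_kernel q -> tame_kernel (q \o -%R).
Proof.
have cN (f : R -> R) : continuous f -> continuous (f \o -%R).
  by move=> cf x; apply: continuous_comp; [exact: opp_continuous|exact: cf].
move=> [cq [V [C [cV VC qV]]]]; split; first exact: cN.
exists (fun u => C - V (- u)), C; split.
- by apply: continuous_fsub; [exact: continuous_const|exact: (cN V)].
- by move=> u; have := VC (- u); lra.
- move=> u v vu /=; rewrite distrC.
  have := qV (- v) (- u); rewrite lerN2 => /(_ vu).
  by rewrite (_ : C - V (- u) - (C - V (- v)) = V (- v) - V (- u)); last ring.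
Qed.

(** The derivatives of the step approximants converge uniformly, which yields
the derivative [D], its continuity and its adjunction formula at once. *)
Lemma convol_approx (lo hi a b : R) (q H : R -> R) :
  tame_kernel q -> continuous H -> a <= b ->
  exists2 D : R -> R, continuous D /\
    forall x : R, is_derive x 1 (convol a b q H) (D x) &
  forall P Psi Psi' : R -> R, continuous P -> continuous Psi' ->
     (forall x : R, is_derive x 1 Psi (Psi' x)) ->
     (forall c, Psi c = \int[mu]_(x in `[lo, hi]) (P x * q (x - c))) ->
     \int[mu]_(x in `[lo, hi]) (P x * D x) =
     - \int[mu]_(s in `[a, b]) (H s * Psi' s).
Proof.
move=> [cq [V [C [cV VC qV]]]] cH ab.
have C0 : 0 <= C by case/andP: (VC 0) => h1 h2; exact: le_trans h2.
have C1 : 0 < C + 1 by rewrite ltr_wpDl.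
have approx e : 0 < e -> exists g g' : R -> R,
  [/\ forall x : R, is_derive x 1 g (g' x), continuous g',
   (forall x y, `|convol a b q H y - convol a b q H x - (g y - g x)| <=
      e * `|y - x|) &
   forall P Psi Psi' : R -> R, continuous P -> continuous Psi' ->
     (forall x : R, is_derive x 1 Psi (Psi' x)) ->
     (forall c, Psi c = \int[mu]_(x in `[lo, hi]) (P x * q (x - c))) ->
     `|\int[mu]_(x in `[lo, hi]) (P x * g' x) +
       \int[mu]_(s in `[a, b]) (H s * Psi' s)| <=
     e * \int[mu]_(s in `[a, b]) `|Psi' s|].
  move=> e0; pose e' := e / (C + 1).
  have e'0 : 0 < e' by rewrite divr_gt0.
  have e'C : e' * C <= e by rewrite ltW// divD1_mulr_lt.
  have e'e : e' <= e by rewrite /e' ler_pdivrMr// ler_peMr ?(ltW e0)// lerDr.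
  have [dl dl0 unif] := segment_unif_continuous a b cH e'0.
  have dl2 : 0 < dl / 2 by rewrite divr_gt0.
  have [n nP] : exists n, (b - a) <= n%:R * (dl / 2).
    exists (Num.bound ((b - a) / (dl / 2))).
    rewrite -ler_pdivrMr// ltW// archi_boundP// divr_ge0// ?subr_ge0//.
    exact: ltW.
  have [|g [g' [dg cg' err adj]]] :=
      convol_step cq cV qV lo hi cH e'0 dl0 _ ab nP.
    by move=> s t tab st; apply/ltW/unif.
  exists g, g'; split => //.
    have errC x y : y <= x ->
       `|convol a b q H x - convol a b q H y - (g x - g y)| <= e * (x - y).
      move=> yx; apply: (le_trans (err _ _ yx)).
      apply: (@le_trans _ _ (e' * (C * (x - y)))).
        by rewrite ler_pM2l//; exact: (variation_integral_le cV VC).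
      by rewrite mulrA ler_wpM2r// subr_ge0.
    move=> x y; case: (leP x y) => [xy|/ltW yx].
      by rewrite [`|y - x|]ger0_norm ?subr_ge0//; exact: errC.
    rewrite [`|y - x|]distrC [`|x - y|]ger0_norm ?subr_ge0//.
    rewrite -normrN; apply: le_trans (errC _ _ yx).
    by rewrite le_eqVlt; apply/orP; left; apply/eqP; congr (`|_|); ring.
  move=> P Psi Psi' cP cPsi' dPsi PsiE.
  apply: le_trans (adj P Psi Psi' cP cPsi' dPsi PsiE) _.
  by rewrite ler_wpM2r// Rintegral_ge0.
have /choice[D DP] : forall x : R, exists l, is_derive x 1 (convol a b q H) l /\
    forall e gl, 0 < e -> is_derive x 1 gl.1 gl.2 ->
     (forall y, `|convol a b q H y - convol a b q H x - (gl.1 y - gl.1 x)| <= e * `|y - x|) ->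
     `|gl.2 - l| <= e.
  move=> x; have [|l dl lP] := @derivable_of_approx _ (convol a b q H) x.
    move=> e e0; have [g [g' [dg _ err _]]] := approx _ e0.
    by exists (g, g' x).
  by exists l.
have cD : continuous D.
  move=> x; apply/continuous_atP => e e0.
  have e3 : 0 < e / 3 by rewrite divr_gt0.
  have [g [g' [dg cg' err _]]] := approx _ e3.
  have gD z : `|g' z - D z| <= e / 3.
    by case: (DP z) => _ /(_ _ (g, g' z)); apply.
  have /continuous_atP/(_ _ e3)[r r0 rP] := cg' x.
  exists r => // y yr; have h := rP _ yr.
  have := gD x; have := gD y; move: h.
  rewrite !ltr_norml !ler_norml; lra.
exists D; first by split=> // x; case: (DP x).
move=> P Psi Psi' cP cPsi' dPsi PsiE.
set I := \int[mu]_(x in _) _; set J := \int[mu]_(x in _) _.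
apply/eqP; rewrite -subr_eq0 opprK -normr_le0; apply/ler_addgt0Pr => e e0.
rewrite add0r.
pose M := \int[mu]_(x in `[lo, hi]) `|P x| + \int[mu]_(s in `[a, b]) `|Psi' s|.
have M0 : 0 <= M by rewrite addr_ge0// Rintegral_ge0.
have M1 : 0 < M + 1 by rewrite ltr_wpDl.
pose e' := e / (M + 1); have e'0 : 0 < e' by rewrite divr_gt0.
have e'M : e' * M <= e by rewrite ltW// divD1_mulr_lt.
have [g [g' [dg cg' err adj]]] := approx _ e'0.
have gD z : `|D z - g' z| <= e'.
  by rewrite distrC; case: (DP z) => _ /(_ _ (g, g' z)); apply.
have -> : I + J = (1 * I + (-1) * \int[mu]_(x in `[lo, hi]) (P x * g' x)) +
   (\int[mu]_(x in `[lo, hi]) (P x * g' x) + J) by ring.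
rewrite -Rintegral_linear; [|exact: continuous_fmul..].
apply: le_trans e'M; rewrite (le_trans (ler_normD _ _))// mulrDr lerD//.
  rewrite -RintegralZl//; last first.
    by apply: continuous_integrable; exact: continuous_abs.
  apply: Rintegral_norm_le.
  - by apply: continuous_linear; exact: continuous_fmul.
  - by apply: continuous_fmul; [exact: continuous_const|exact: continuous_abs].
  - move=> x _; have -> : 1 * (P x * D x) + -1 * (P x * g' x) = (D x - g' x) * P x.
      by ring.
    by rewrite normrM ler_wpM2r.
exact: adj.
Qed.

Definition dconvol (a b : R) (q H : R -> R) : R -> R := derive1 (convol a b q H).

Lemma is_derive_convol (a b : R) (q H : R -> R) (x : R) :
  tame_kernel q -> continuous H -> a <= b ->
  is_derive x 1 (convol a b q H) (dconvol a b q H x).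
Proof.
move=> tq cH ab; have [D [cD dD] _] := convol_approx a b tq cH ab.
by rewrite /dconvol derive1E; case: (dD x) => dx _; exact: DeriveDef.
Qed.

Lemma continuous_dconvol (a b : R) (q H : R -> R) :
  tame_kernel q -> continuous H -> a <= b -> continuous (dconvol a b q H).
Proof.
move=> tq cH ab; have [D [cD dD] _] := convol_approx a b tq cH ab.
rewrite (_ : dconvol _ _ _ _ = D)//; apply/funext => x.
by rewrite /dconvol derive1E; case: (dD x).
Qed.

(** Integration by parts without boundary terms: formally both sides are the
integral of [P x * H s] against the measure [dq (x - s)]. *)
Lemma dconvol_adjoint (a b : R) (q P H : R -> R) :
  tame_kernel q -> continuous P -> continuous H -> a <= b ->
  \int[mu]_(x in `[a, b]) (P x * dconvol a b q H x) =
  - \int[mu]_(x in `[a, b]) (H x * dconvol a b (q \o -%R) P x).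
Proof.
move=> tq cP cH ab; have [D [cD dD] adj] := convol_approx a b tq cH ab.
rewrite (_ : dconvol a b q H = D); last first.
  by apply/funext => x; rewrite /dconvol derive1E; case: (dD x).
have tqN := tame_kernelN tq.
apply: (adj P (convol a b (q \o -%R) P) (dconvol a b (q \o -%R) P) cP).
- exact: continuous_dconvol.
- by move=> x; exact: is_derive_convol.
- move=> c; apply: eq_Rintegral => x _ /=.
  by rewrite opprB.
Qed.

Lemma dconvol_linear (a b : R) (q H G : R -> R) (k x : R) :
  tame_kernel q -> continuous H -> continuous G -> a <= b ->
  dconvol a b q (fun s => H s + k * G s) x =
  dconvol a b q H x + k * dconvol a b q G x.
Proof.
move=> tq cH cG ab; rewrite {1}/dconvol derive1E.
have -> : convol a b q (fun s => H s + k * G s) =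
    (convol a b q H + k *: convol a b q G)%R.
  apply/funext => y.
  rewrite [RHS](_ : _ = 1 * convol a b q H y + k * convol a b q G y); last first.
    by rewrite mul1r.
  rewrite /convol -Rintegral_linear; first last.
  - by apply: continuous_fmul => //; exact: continuous_shift (proj1 tq).
  - by apply: continuous_fmul => //; exact: continuous_shift (proj1 tq).
  by apply: eq_Rintegral => s _; ring.
have d1 := is_derive_convol x tq cH ab.
have d2 := is_derive_convol x tq cG ab.
have : is_derive x 1 (convol a b q H + k *: convol a b q G)
   (dconvol a b q H x + k *: dconvol a b q G x) by apply: is_deriveD.
by case.
Qed.

End convolution_derivative.

(** * The Mittag-Leffler function *)

Section mittag_leffler_kernel.
Context {R : realType}.
Notation mu := (@lebesgue_measure R).
Implicit Types (beta z : R).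

Lemma Gamma_ge0 (x : R) : 0 <= Gamma x.
Proof. by apply: Rintegral_ge0 => t _; rewrite mulr_ge0 ?powR_ge0 ?expR_ge0. Qed.

(** The integrand exceeds [M `^ p * expR (- (M + 1))] on `[M, M + 1]. Convergence
of the integral is not at stake: were it infinite, its real value would be 0,
and so would the inverse. *)
Lemma Gamma_inv_le (p M : R) : 0 <= p -> 0 < M ->
  (Gamma (p + 1))^-1 <= expR (M + 1) / M `^ p.
Proof.
move=> p0 M0.
have Mp : 0 < M `^ p by exact: powR_gt0.
have r0 : 0 < expR (M + 1) / M `^ p by rewrite divr_gt0// expR_gt0.
rewrite /Gamma /Rintegral; set I := (\int[mu]_(t in _) _)%E.
have fge0 (t : R) : (0 <= (t `^ (p + 1 - 1) * expR (- t))%:E)%E.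
  by rewrite lee_fin mulr_ge0 ?powR_ge0 ?expR_ge0.
pose f (t : R) : R := t `^ (p + 1 - 1) * expR (- t).
have mf : measurable_fun [set: R] (EFin \o f).
  apply/measurable_EFinP; apply: measurable_funM; first exact: measurable_powR.
  by apply: measurableT_comp => //; exact: measurableT_comp.
have KI : ((M `^ p * expR (- (M + 1)))%:E <= I)%E.
  apply: (@le_trans _ _ (\int[mu]_(t in `[M, (M + 1)%R]) (t `^ (p + 1 - 1) * expR (- t))%:E)%E).
    have -> : (M `^ p * expR (- (M + 1)))%:E =
      (\int[mu]_(t in `[M, (M + 1)%R]) (cst (M `^ p * expR (- (M + 1)))%:E t))%E.
      rewrite integral_cst//= lebesgue_measure_itv/= lte_fin ltrDl ltr01.
      by rewrite -EFinD addrAC subrr add0r mule1.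
    apply: ge0_le_integral => //=.
    - by move=> t _; rewrite lee_fin mulr_ge0 ?powR_ge0 ?expR_ge0.
    - exact: measurable_funTS.
    - move=> t /=; rewrite in_itv/= => /andP[Mt tM]; rewrite lee_fin addrK.
      apply: ler_pM; rewrite ?powR_ge0 ?expR_ge0//.
        by apply: ge0_ler_powR; rewrite ?nnegrE ?(ltW M0)// (le_trans (ltW M0)).
      by rewrite ler_expR lerN2.
  apply: ge0_subset_integral => //=; first exact: measurable_funTS.
  by move=> t /=; rewrite !in_itv/= andbT => /andP[Mt _]; rewrite (lt_le_trans M0).
case: I KI => [r| |].
- rewrite lee_fin /= => Kr.
  rewrite -(invrK (expR (M + 1) / M `^ p)) lef_pV2 ?posrE ?invr_gt0//.
    by apply: le_trans Kr; rewrite invf_div expRN.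
  by apply: lt_le_trans Kr; rewrite mulr_gt0// expR_gt0.
- by move=> _; rewrite /= invr0 ltW.
- by rewrite leeNy_eq.
Qed.

Definition ml_term beta z (j : nat) : R := z ^+ j / Gamma (beta * j%:R + 1).

(** Choosing [M `^ beta = r] in the bound on [1 / Gamma] cancels [r ^+ j], so the
Mittag-Leffler series has infinite radius of convergence. *)
Lemma ml_term_bound beta (r : R) : 0 < beta -> 0 < r ->
  exists A, forall j, ml_term beta r j <= A.
Proof.
move=> beta0 r0; pose M := r `^ beta^-1.
have M0 : 0 < M by exact: powR_gt0.
exists (expR (M + 1)) => j.
rewrite /ml_term mulrC -ler_pdivlMr ?exprn_gt0//.
have := @Gamma_inv_le (beta * j%:R) M (mulr_ge0 (ltW beta0) (ler0n _ _)) M0.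
have Mr : M `^ beta = r by rewrite /M -powRrM mulVf ?gt_eqF// powRr1 ?ltW.
by rewrite powRrM Mr powR_mulrn// ltW.
Qed.

Lemma ml_norm_cvg beta z : 0 < beta -> cvgn [normed series (ml_term beta z)].
Proof.
move=> beta0; pose r := 2 * (`|z| + 1).
have r0 : 0 < r by rewrite mulr_gt0// ltr_wpDl.
have [A AP] := ml_term_bound beta0 r0.
have A0 : 0 <= A.
  by apply: le_trans (AP 0); rewrite /ml_term expr0 mul1r invr_ge0 Gamma_ge0.
apply: (@series_le_cvg _ _ (geometric A 2^-1)) => //.
- by move=> n; exact: normr_ge0.
- by move=> n; rewrite /= mulr_ge0// exprn_ge0// invr_ge0.
- move=> n; rewrite /geometric/= exprVn ler_pdivlMr ?exprn_gt0//.
  apply: le_trans (AP n).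
  rewrite /ml_term normrM normfV (ger0_norm (Gamma_ge0 _)) mulrAC normrX.
  rewrite ler_wpM2r ?invr_ge0 ?Gamma_ge0// -exprMn lerXn2r ?nnegrE ?mulr_ge0 ?addr_ge0//.
  by rewrite mulrC ler_pM2l// lerDl.
- apply: is_cvg_geometric_series; rewrite ger0_norm ?invr_ge0//.
  by rewrite invf_lt1// ltr1n.
Qed.

Lemma ml_cvg beta z : 0 < beta -> cvgn (series (ml_term beta z)).
Proof. by move=> /(@ml_norm_cvg beta z)/normed_cvg. Qed.

Lemma mittag_lefflerE beta z : mittag_leffler beta z = limn (series (ml_term beta z)).
Proof. by []. Qed.

Lemma ml_dist_le beta (x y : R) (d : nat -> R) : 0 < beta -> cvgn (series d) ->
  (forall j, `|x ^+ j - y ^+ j| / Gamma (beta * j%:R + 1) <= d j) ->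
  `|mittag_leffler beta x - mittag_leffler beta y| <= limn (series d).
Proof.
move=> beta0 cd dP; have cx := @ml_cvg beta x beta0; have cy := @ml_cvg beta y beta0.
rewrite !mittag_lefflerE -limB// -lim_norm; last exact: is_cvgB.
apply: ler_lim => //; first by apply: is_cvg_norm; exact: is_cvgB.
near=> n.
rewrite [X in `|X|](_ : _ =
  \sum_(0 <= j < n) (ml_term beta x j - ml_term beta y j)); last by rewrite sumrB.
rewrite (le_trans (ler_norm_sum _ _ _))//.
apply: ler_sum => j _; apply: le_trans (dP j).
by rewrite /ml_term -mulrBl normrM normfV (ger0_norm (Gamma_ge0 _)).
Unshelve. all: by end_near. Qed.

Lemma mittag_leffler_ge0 beta z : 0 < beta -> 0 <= z -> 0 <= mittag_leffler beta z.
Proof.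
move=> beta0 z0; rewrite mittag_lefflerE; apply: limr_ge; first exact: ml_cvg.
apply: nearW => n; rewrite /series/= sumr_ge0// => j _.
by rewrite /ml_term divr_ge0 ?exprn_ge0 ?Gamma_ge0.
Qed.

(** Term by term, [(- x) ^+ j - (- y) ^+ j] is [x ^+ j - y ^+ j] up to sign, and
the latter is nonnegative: the alternating series varies less than the series
with nonnegative terms, which serves as the dominating function [V]. *)
Lemma mittag_leffler_variation beta (x y : R) : 0 < beta -> 0 <= y -> y <= x ->
  `|mittag_leffler beta (- x) - mittag_leffler beta (- y)| <=
  mittag_leffler beta x - mittag_leffler beta y.
Proof.
move=> beta0 y0 yx; have x0 := le_trans y0 yx.
have cx := @ml_cvg beta x beta0; have cy := @ml_cvg beta y beta0.
have dE : series (fun j => ml_term beta x j - ml_term beta y j) =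
    series (ml_term beta x) - series (ml_term beta y).
  by apply/funext => n; rewrite /series/= sumrB.
rewrite [leRHS](_ : _ =
  limn (series (fun j => ml_term beta x j - ml_term beta y j))); last first.
  by rewrite dE !mittag_lefflerE limB.
apply: ml_dist_le => //; first by rewrite dE; exact: is_cvgB.
move=> j; rewrite /ml_term -mulrBl ler_wpM2r ?invr_ge0 ?Gamma_ge0//.
rewrite exprNn (exprNn y) -mulrBr normrM normrX normrN1 expr1n mul1r.
by rewrite ger0_norm// subr_ge0 lerXn2r ?nnegrE.
Qed.

Lemma continuous_mittag_leffler beta : 0 < beta -> continuous (mittag_leffler beta).
Proof.
move=> beta0 x; apply/continuous_atP => e e0.
pose K := `|x| + 1; have K1 : 1 <= K by rewrite lerDr.
have powB y j : `|y| <= K -> `|y ^+ j - x ^+ j| <= `|y - x| * (2 * K) ^+ j.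
  move=> yK; have xK : `|x| <= K by rewrite lerDl.
  elim: j => [|j IH]; first by rewrite !expr0 subrr normr0 mulr1.
  have -> : y ^+ j.+1 - x ^+ j.+1 = y * (y ^+ j - x ^+ j) + (y - x) * x ^+ j.
    by rewrite !exprS; ring.
  rewrite (le_trans (ler_normD _ _))// !normrM normrX.
  have K0 : 0 <= K by lra.
  have h1 : `|y| * `|y ^+ j - x ^+ j| <= K * (`|y - x| * (2 * K) ^+ j).
    by apply: ler_pM.
  have h2 : `|y - x| * `|x| ^+ j <= `|y - x| * (K * (2 * K) ^+ j).
    rewrite ler_wpM2l// -[leLHS]mul1r ler_pM ?exprn_ge0//.
    by rewrite lerXn2r ?nnegrE ?mulr_ge0// (le_trans xK)//; lra.
  rewrite exprS; apply: le_trans (lerD h1 h2) _.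
  by rewrite le_eqVlt; apply/orP; left; apply/eqP; ring.
pose S := mittag_leffler beta (2 * K).
have S0 : 0 <= S by apply: mittag_leffler_ge0 => //; lra.
have S1 : 0 < S + 1 by lra.
exists (Num.min 1 (e / (S + 1))); first by rewrite lt_min ltr01 divr_gt0.
move=> y; rewrite lt_min => /andP[y1 ye].
have yK : `|y| <= K.
  by rewrite /K -(subrK x y) (le_trans (ler_normD _ _))// addrC lerD2l ltW.
have cK := @ml_cvg beta (2 * K) beta0.
apply: (@le_lt_trans _ _ (limn (series (fun j => `|y - x| *: ml_term beta (2 * K) j)))).
  apply: ml_dist_le => //; first by apply: is_cvg_seriesZ.
  move=> j; rewrite -[_ *: _]/(_ * _) /ml_term mulrA.
  by rewrite ler_wpM2r ?invr_ge0 ?Gamma_ge0// powB.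
rewrite lim_seriesZ// -[_ *: _]/(_ * S).
apply: (@le_lt_trans _ _ (`|y - x| * (S + 1))).
  by rewrite ler_wpM2l// lerDl.
by rewrite -ltr_pdivlMr.
Qed.

End mittag_leffler_kernel.

(** * Functions and derivatives on a segment *)

Section clamp.
Context {R : realType}.

(** All data are only controlled on `[a, b]; composing with the projection onto
the segment turns continuity there into continuity on the line. *)
Definition clamp (c d x : R) : R := Num.max c (Num.min x d).

Lemma clamp_itv (c d x : R) : c <= d -> clamp c d x \in `[c, d].
Proof. by move=> cd; rewrite in_itv/= /clamp le_max lexx/= ge_max cd ge_min lexx orbT. Qed.

Lemma clamp_id (c d x : R) : x \in `[c, d] -> clamp c d x = x.
Proof. by rewrite in_itv/= => /andP[cx xd]; rewrite /clamp (min_idPl xd) (max_idPr cx). Qed.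

Lemma clamp_homo (c d : R) : {homo clamp c d : x y / x <= y}.
Proof.
move=> x y xy; rewrite /clamp ge_max !le_max lexx/= le_min !ge_min xy lexx.
by rewrite !orbT.
Qed.

Lemma continuous_clamp (c d : R) : continuous (clamp c d).
Proof.
move=> x; apply: (@continuous_max R R (fun=> c) (fun y => Num.min y d)).
  exact: cvg_cst.
by apply: (@continuous_min R R id (fun=> d)); [exact: cvg_id|exact: cvg_cst].
Qed.

Lemma continuous_within_comp {T U W : topologicalType} (A : set U)
    (f : U -> W) (g : T -> U) : {within A, continuous f} -> continuous g ->
  (forall t, A (g t)) -> continuous (f \o g).
Proof.
move=> /subspace_continuousP cf cg Ag t.
move=> P /(cf _ (Ag t)); rewrite /within /= => /cg; rewrite /nbhs/=.
by apply: filterS => y; apply.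
Qed.

Lemma continuous_clamp_comp (c d : R) (f : R -> R) : c <= d ->
  {within `[c, d], continuous f} -> continuous (f \o clamp c d).
Proof.
move=> cd cf; apply: continuous_within_comp cf _ _; first exact: continuous_clamp.
by move=> t; exact: clamp_itv.
Qed.

Lemma continuous_powR_max (p : R) : 0 < p ->
  continuous (fun u : R => (Num.max 0 u) `^ p).
Proof.
move=> p0 x; have [x0|x0|->] := ltgtP x 0.
- apply/continuous_atP => e e0; exists (- x); first by rewrite oppr_gt0.
  move=> y /ltr_normlP[_ yx].
  by rewrite !(max_idPl _) ?subrr ?normr0//; lra.
- have /continuous_atP cx : {for x, continuous (fun u : R => u `^ p)}.
    apply: differentiable_continuous; apply/derivable1_diffP.
    by apply: derivable_powR; rewrite in_itv/= x0.
  apply/continuous_atP => e e0; have [r r0 rP] := cx _ e0.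
  exists (Num.min r x); first by rewrite lt_min r0.
  move=> y; rewrite lt_min => /andP[yr /ltr_normlP[yx _]].
  by rewrite !(max_idPr _) ?(ltW x0)//; [exact: rP|lra].
- apply/continuous_atP => e e0.
  have /cvgrPdist_lt/(_ _ e0) := powR_cvg0 p0.
  move=> /nbhs_ballP[r /= r0 rP]; exists r => // y yr.
  rewrite maxxx powR0 ?gt_eqF// subr0.
  have [y0|y0] := leP y 0; first by rewrite powR0 ?gt_eqF// normr0.
  have := rP y; rewrite /ball/= sub0r normrN -{1}[y]subr0 => /(_ yr y0).
  by rewrite sub0r normrN.
Qed.

End clamp.

Section relative_derivative.
Context {R : realType}.
Variables a b : R.
Hypothesis ab : a < b.

Lemma within_punctured_proper (x : R) : x \in `[a, b] ->
  ProperFilter (within `[a, b] x^').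
Proof.
rewrite in_itv/= => /andP[ax xb].
split; last exact: _.
rewrite /within/= => /nbhs_ballP[r /= r0 rP].
have [xb'|] := ltP x b.
  pose y := Num.min b (x + r / 2).
  have xy : x < y by rewrite lt_min xb' ltrDl divr_gt0.
  have yb : y <= b by rewrite ge_min lexx.
  have yr : y <= x + r / 2 by rewrite ge_min lexx orbT.
  apply: (rP y); rewrite /ball/= ?gt_eqF//.
    rewrite ltr_norml; lra.
  by rewrite in_itv/= yb andbT (le_trans ax)// ltW.
move=> bx; have {}bx : x = b by apply/eqP; rewrite eq_le xb.
pose y := Num.max a (x - r / 2).
have xy : y < x by rewrite gt_max {1}bx ab ltrBlDr ltrDl divr_gt0.
have yb : a <= y by rewrite le_max lexx.
have yr : x - r / 2 <= y by rewrite le_max lexx orbT.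
apply: (rP y); rewrite /ball/= ?lt_eqF//.
  rewrite ltr_norml; lra.
by rewrite in_itv/= yb (le_trans (ltW xy)).
Qed.

(** The bridge to ordinary derivatives: at the endpoints as well, the derivative
relative to the segment is that of any extension differentiable there. *)
Lemma deriv_in_eq (f g : R -> R) (x l : R) : x \in `[a, b] ->
  {in `[a, b], f =1 g} -> is_derive x 1 g l ->
  derivable_in `[a, b] f x /\ deriv_in `[a, b] f x = l.
Proof.
move=> xab fg /is_derive_epsP gl.
have cl : diff_quot f x y @[y --> within `[a, b] x^'] --> l.
  apply/cvgrPdist_le => e e0; have [r r0 rP] := gl _ e0.
  apply/nbhs_ballP; exists r => // y; rewrite /ball/= distrC => yr yx yab.
  have yx0 : y - x != 0 by rewrite subr_eq0.
  rewrite /diff_quot !fg// -(@ler_pM2r _ `|y - x|) ?normr_gt0// -normrM.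
  rewrite mulrBl divfK// -normrN opprB.
  exact: rP.
have pf := within_punctured_proper xab.
by split; [apply/cvg_ex; exists l|exact: cvg_lim].
Qed.

Lemma derivable_in_continuous (f : R -> R) :
  (forall x, x \in `[a, b] -> derivable_in `[a, b] f x) ->
  {within `[a, b], continuous f}.
Proof.
move=> df; apply/subspace_continuousP => x xab.
have /cvg_ex[l /cvgrPdist_lt/(_ _ ltr01)] := df x xab.
move=> /nbhs_ballP[r /= r0 rP].
apply/cvgrPdist_lt => e e0.
have l0 : 0 < `|l| + 1 by rewrite ltr_wpDl.
apply/nbhs_ballP; exists (Num.min r (e / (`|l| + 1))) => /=.
  by rewrite lt_min r0 divr_gt0.
move=> y; rewrite /ball/= lt_min => /andP[yr ye] yab.
have [->|yx] := eqVneq y x; first by rewrite subrr normr0.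
have /ltW dq := rP y yr yx yab.
have yx0 : y - x != 0 by rewrite subr_eq0.
rewrite distrC -(divfK yx0 (f y - f x)) normrM.
apply: (@le_lt_trans _ _ ((`|l| + 1) * `|y - x|)).
  rewrite ler_wpM2r// -/(diff_quot f x y) -(subrK l (diff_quot f x y)).
  by rewrite (le_trans (ler_normD _ _))// addrC lerD2l distrC.
by rewrite mulrC -ltr_pdivlMr// distrC.
Qed.

End relative_derivative.

(** * The weighted fractional derivatives *)

Section fractional_kernel.
Context {R : realType}.
Variables (alpha beta T : R).
Hypothesis T0 : 0 <= T.
Hypothesis alpha0 : 0 <= alpha.
Hypothesis alpha1 : alpha < 1.
Hypothesis beta0 : 0 < beta.

Definition kernel_tail (u : R) : R :=
  frac_kernel alpha beta (clamp 0 T u) - frac_kernel alpha beta 0.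

(** The argument is clamped at [T] too, which keeps the dominating function
bounded and changes nothing on differences of points of a segment of length
[T]. *)
Lemma tame_kernel_tail : tame_kernel kernel_tail.
Proof.
have m0 : 0 <= frac_mu alpha by rewrite divr_ge0// subr_ge0 ltW.
pose p (u : R) : R := frac_mu alpha * (clamp 0 T u) `^ beta.
have p0 u : 0 <= p u by rewrite mulr_ge0// powR_ge0.
have cp : continuous p.
  apply: continuous_fmul; first exact: continuous_const.
  have E : (fun s => clamp 0 T s `^ beta) =
      (fun u => Num.max 0 u `^ beta) \o clamp 0 T.
    apply/funext => s /=; have := clamp_itv s T0.
    by rewrite in_itv/= => /andP[/max_idPr ->].
  rewrite E => x; apply: continuous_comp; first exact: continuous_clamp.
  exact: continuous_powR_max.
have pmono u v : v <= u -> p v <= p u.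
  move=> vu; rewrite ler_wpM2l// ge0_ler_powR ?nnegrE ?(ltW beta0)//.
  - by have := clamp_itv v T0; rewrite in_itv/= => /andP[].
  - by have := clamp_itv u T0; rewrite in_itv/= => /andP[].
  - exact: clamp_homo.
have cE := continuous_mittag_leffler beta0.
have kE u : kernel_tail u = mittag_leffler beta (- p u) - frac_kernel alpha beta 0.
  by rewrite /kernel_tail /frac_kernel mulNr.
split.
  rewrite (funext kE); apply: continuous_fsub; last exact: continuous_const.
  move=> x; apply: (@continuous_comp _ _ _ (fun u => - p u)); last exact: cE.
  by apply: cvgN; exact: cp.
exists (fun u => mittag_leffler beta (p u)), (mittag_leffler beta (p T)).
split.
- by move=> x; apply: continuous_comp; [exact: cp|exact: cE].
- move=> u; rewrite (mittag_leffler_ge0 beta0 (p0 u)) /=.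
  have pu : p u <= p T.
    have [ub|/ltW ub] := leP u T; first exact: pmono.
    rewrite /p /clamp minxx (min_idPr ub) lexx //.
  have := mittag_leffler_variation beta0 (p0 u) pu.
  by move=> /(le_trans (normr_ge0 _)); rewrite subr_ge0.
- move=> u v vu; rewrite !kE opprB addrA subrK.
  exact: (mittag_leffler_variation beta0 (p0 v) (pmono u v vu)).
Qed.

(** Splitting off the value at 0 leaves a kernel vanishing on the negative
reals, so that integrals over `[a, x] and `[x, b] become integrals over the
fixed segment `[a, b]. *)
Lemma frac_kernel_split : exists q : R -> R, [/\ tame_kernel q,
  forall u, u <= 0 -> q u = 0 &
  forall u, u \in `[0, T] ->
    frac_kernel alpha beta u = frac_kernel alpha beta 0 + q u].
Proof.
exists kernel_tail; split; first exact: tame_kernel_tail.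
- move=> u u0; rewrite /kernel_tail /clamp (max_idPl _) ?subrr//.
  by rewrite ge_min u0.
- by move=> u u0; rewrite /kernel_tail clamp_id// addrC subrK.
Qed.

End fractional_kernel.

Section fractional_derivatives.
Context {R : realType}.
Notation mu := (@lebesgue_measure R).
Variables (a b alpha beta : R) (B : R -> R) (w : R -> R).
Hypothesis ab : a < b.
Variables (k0 : R) (q : R -> R).
Hypothesis tq : tame_kernel q.
Hypothesis q_le0 : forall u, u <= 0 -> q u = 0.
Hypothesis q_split : forall u, u \in `[0, b - a] ->
  frac_kernel alpha beta u = k0 + q u.

Definition wext (f : R -> R) : R -> R := (fun s => w s * f s) \o clamp a b.

Lemma wextE (f : R -> R) s : s \in `[a, b] -> wext f s = w s * f s.
Proof. by move=> sab; rewrite /wext/= clamp_id. Qed.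

Lemma wint_leftE (f : R -> R) x : continuous (wext f) -> x \in `[a, b] ->
  wint_left a alpha beta w f x =
  k0 * \int[mu]_(s in `[a, x]) wext f s + convol a b q (wext f) x.
Proof.
move=> cf; rewrite in_itv/= => /andP[ax xb]; have [cq _] := tq.
have cFq : continuous (fun s => wext f s * q (x - s)).
  exact: (continuous_fmul cf (continuous_shift (x:=x) cq)).
rewrite /convol (Rintegral_split cFq ax xb).
rewrite [X in _ + (_ + X)](_ : _ = 0) ?addr0; last first.
  rewrite (@eq_Rintegral _ _ _ mu `[x, b]%classic (fun=> 0 * (0 : R))).
    by rewrite Rintegral_const// mul0r mul0r.
  move=> s; rewrite inE/= in_itv/= => /andP[xs _].
  by rewrite q_le0 ?subr_le0// mulr0 mul0r.
rewrite -[X in _ + X]mul1r -Rintegral_linear//.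
apply: eq_Rintegral => s; rewrite inE/= in_itv/= => /andP[as_ sx].
rewrite wextE; last by rewrite in_itv/= as_ (le_trans sx).
rewrite q_split; first by ring.
by rewrite in_itv/= subr_ge0 sx lerB.
Qed.

Lemma wint_rightE (f : R -> R) x : continuous (wext f) -> x \in `[a, b] ->
  wint_right b alpha beta w f x =
  k0 * \int[mu]_(s in `[x, b]) wext f s +
  convol a b (q \o -%R) (wext f) x.
Proof.
move=> cf; rewrite in_itv/= => /andP[ax xb].
have [cq _] := tame_kernelN tq.
have cFq : continuous (fun s => wext f s * (q \o -%R) (x - s)).
  exact: (continuous_fmul cf (continuous_shift (x:=x) cq)).
rewrite /convol (Rintegral_split cFq ax xb).
rewrite [X in _ + (X + _)](_ : _ = 0) ?add0r; last first.
  rewrite (@eq_Rintegral _ _ _ mu `[a, x]%classic (fun=> 0 * (0 : R))).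
    by rewrite Rintegral_const// mul0r mul0r.
  move=> s; rewrite inE/= in_itv/= => /andP[_ sx].
  by rewrite opprB q_le0 ?subr_le0// mulr0 mul0r.
rewrite -[X in _ + X]mul1r -Rintegral_linear//.
apply: eq_Rintegral => s; rewrite inE/= in_itv/= => /andP[xs sb].
rewrite wextE; last by rewrite in_itv/= sb (le_trans ax).
rewrite opprB q_split; first by ring.
by rewrite in_itv/= subr_ge0 xs lerB.
Qed.

(** The derivative exists for every continuous [w * f]: the constant part of the
kernel contributes [k0 * w * f], the rest a convolution of class C^1. *)
Lemma wRD_left_spec (f : R -> R) t : continuous (wext f) -> t \in `[a, b] ->
  wRD_left_exists a b alpha beta w f t /\
  wRD_left a b B alpha beta w f t = 1 / frac_phi B alpha * (1 / w t) *
    (k0 * wext f t + dconvol a b q (wext f) t).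
Proof.
move=> cf tab; have [F dF] := antiderivative cf.
have dC := is_derive_convol t tq cf (ltW ab).
have dG := is_deriveD (is_deriveZ k0 (is_deriveB (dF t) (is_derive_cst (F a) t 1))) dC.
have fg : {in `[a, b], wint_left a alpha beta w f =1
    k0 *: (F - cst (F a)) + convol a b q (wext f)}.
  move=> x xab; rewrite wint_leftE// (Rintegral_FTC cf _ dF)//.
  by move: xab; rewrite in_itv/= => /andP[].
have [ex E] := deriv_in_eq ab tab fg dG.
by split=> //; rewrite /wRD_left E subr0.
Qed.

Lemma wRD_right_spec (f : R -> R) t : continuous (wext f) -> t \in `[a, b] ->
  wRD_right_exists a b alpha beta w f t /\
  wRD_right a b B alpha beta w f t = - 1 / frac_phi B alpha * (1 / w t) *
    (- (k0 * wext f t) + dconvol a b (q \o -%R) (wext f) t).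
Proof.
move=> cf tab; have [F dF] := antiderivative cf.
have dC := is_derive_convol t (tame_kernelN tq) cf (ltW ab).
have dG := is_deriveD (is_deriveZ k0 (is_deriveB (is_derive_cst (F b) t 1) (dF t))) dC.
have fg : {in `[a, b], wint_right b alpha beta w f =1
    k0 *: (cst (F b) - F) + convol a b (q \o -%R) (wext f)}.
  move=> x xab; rewrite wint_rightE// (Rintegral_FTC cf _ dF)//.
  by move: xab; rewrite in_itv/= => /andP[].
have [ex E] := deriv_in_eq ab tab fg dG.
by split=> //; rewrite /wRD_right E sub0r scalerN.
Qed.

Lemma wext_linear (f g : R -> R) (k : R) :
  wext (fun s => f s + k * g s) = (fun s => wext f s + k * wext g s).
Proof. by apply/funext => s; rewrite /wext/=; ring. Qed.

Lemma wRD_linear (f g : R -> R) (k t : R) :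
  continuous (wext f) -> continuous (wext g) -> t \in `[a, b] ->
  wRD_left a b B alpha beta w (fun s => f s + k * g s) t =
    wRD_left a b B alpha beta w f t + k * wRD_left a b B alpha beta w g t /\
  wRD_right a b B alpha beta w (fun s => f s + k * g s) t =
    wRD_right a b B alpha beta w f t + k * wRD_right a b B alpha beta w g t.
Proof.
move=> cf cg tab.
have cfg : continuous (wext (fun s => f s + k * g s)).
  rewrite wext_linear => s; apply: cvgD; first exact: cf.
  by apply: cvgM; [exact: cvg_cst|exact: cg].
have tqN := tame_kernelN tq.
rewrite !(proj2 (wRD_left_spec _ tab))// !(proj2 (wRD_right_spec _ tab))//.
rewrite wext_linear (dconvol_linear k t tq cf cg (ltW ab)).
rewrite (dconvol_linear k t tqN cf cg (ltW ab)).
by split; ring.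
Qed.

(** Left and right derivatives are adjoint for the weight [w ^+ 2]. With
[G = P / w] and [H = w * h] the factor [1 / w] of each operator is absorbed,
the terms in [k0] are symmetric in [G] and [H], and the rest is the adjunction
of the convolutions by [q] and its reflection. *)
Lemma wRD_adjoint (P h : R -> R) : (forall t, t \in `[a, b] -> 0 < w t) ->
  continuous (wext (fun s => P s / w s ^+ 2)) -> continuous (wext h) ->
  \int[mu]_(t in `[a, b]) (P t * wRD_left a b B alpha beta w h t) =
  \int[mu]_(t in `[a, b]) (h t * (w t ^+ 2 *
     wRD_right a b B alpha beta w (fun s => P s / w s ^+ 2) t)) /\
  \int[mu]_(t in `[a, b]) (P t * wRD_right a b B alpha beta w h t) =
  \int[mu]_(t in `[a, b]) (h t * (w t ^+ 2 *
     wRD_left a b B alpha beta w (fun s => P s / w s ^+ 2) t)).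
Proof.
move=> w0; set G := wext (fun s => _); set H := wext h => cG cH.
have tqN := tame_kernelN tq.
have abW := ltW ab.
pose c := 1 / frac_phi B alpha.
have GE t : t \in `[a, b] -> P t / w t = G t.
  move=> tab; rewrite /G wextE//; have := gt_eqF (w0 _ tab) => wt.
  by field; rewrite wt.
have HE t : t \in `[a, b] -> h t * w t = H t.
  by move=> tab; rewrite /H wextE// mulrC.
have cdG q' : tame_kernel q' -> continuous (fun t => H t * dconvol a b q' G t).
  by move=> *; apply: continuous_fmul => //; exact: continuous_dconvol.
have cdH q' : tame_kernel q' -> continuous (fun t => G t * dconvol a b q' H t).
  by move=> *; apply: continuous_fmul => //; exact: continuous_dconvol.
have cGH : continuous (fun t => G t * H t) by exact: continuous_fmul.
have adj := dconvol_adjoint tq cG cH abW.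
have adjN := dconvol_adjoint tqN cG cH abW.
have NN : (q \o -%R) \o -%R = q by apply/funext => u /=; rewrite opprK.
rewrite NN in adjN.
have cN : - 1 / frac_phi B alpha = - c by rewrite /c mulNr.
have lH t : t \in `[a, b] -> wRD_left a b B alpha beta w h t =
    c * (1 / w t) * (k0 * H t + dconvol a b q H t).
  by move=> tab; rewrite (proj2 (wRD_left_spec cH tab)).
have rH t : t \in `[a, b] -> wRD_right a b B alpha beta w h t =
    - c * (1 / w t) * (- (k0 * H t) + dconvol a b (q \o -%R) H t).
  by move=> tab; rewrite (proj2 (wRD_right_spec cH tab)) cN.
have lG t : t \in `[a, b] ->
    wRD_left a b B alpha beta w (fun s => P s / w s ^+ 2) t =
    c * (1 / w t) * (k0 * G t + dconvol a b q G t).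
  by move=> tab; rewrite (proj2 (wRD_left_spec cG tab)).
have rG t : t \in `[a, b] ->
    wRD_right a b B alpha beta w (fun s => P s / w s ^+ 2) t =
    - c * (1 / w t) * (- (k0 * G t) + dconvol a b (q \o -%R) G t).
  by move=> tab; rewrite (proj2 (wRD_right_spec cG tab)) cN.
clearbody c G H.
split.
- transitivity ((c * k0) * \int[mu]_(t in `[a, b]) (G t * H t) +
     c * \int[mu]_(t in `[a, b]) (G t * dconvol a b q H t)).
    rewrite -Rintegral_linear//; last exact: cdH.
    by apply: eq_Rintegral => t; rewrite inE/= => tab; rewrite lH// -GE//; ring.
  rewrite adj mulrN -mulNr.
  rewrite -(Rintegral_linear (c * k0) (- c) a b cGH (cdG _ tqN)).
  apply: eq_Rintegral => t; rewrite inE/= => tab; rewrite rG// -HE//.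
  by have := gt_eqF (w0 _ tab) => wt; field; rewrite wt.
- transitivity ((c * k0) * \int[mu]_(t in `[a, b]) (G t * H t) +
     (- c) * \int[mu]_(t in `[a, b]) (G t * dconvol a b (q \o -%R) H t)).
    rewrite -Rintegral_linear//; last exact: cdH.
    by apply: eq_Rintegral => t; rewrite inE/= => tab; rewrite rH// -GE//; ring.
  rewrite adjN mulrNN.
  rewrite -(Rintegral_linear (c * k0) c a b cGH (cdG _ tq)).
  apply: eq_Rintegral => t; rewrite inE/= => tab; rewrite lG// -HE//.
  by have := gt_eqF (w0 _ tab) => wt; field; rewrite wt.
Qed.

End fractional_derivatives.

Section segment_tools.
Context {R : realType}.
Implicit Types h : R -> R.

Lemma segment_bounded (a b : R) h : continuous h ->
  exists2 K, 0 < K & forall t, t \in `[a, b] -> `|h t| <= K.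
Proof.
move=> ch.
(* the tolerance [r] stands for the bound [r^-1] *)
have [|r r0 rP] := @segment_uniform R a b (fun r t => `|h t| <= r^-1).
  move=> t _; have K0 : 0 < `|h t| + 1 by rewrite ltr_wpDl.
  have /continuous_atP/(_ _ ltr01)[d d0 dP] := ch t.
  exists (Num.min d (`|h t| + 1)^-1); first by rewrite lt_min d0 invr_gt0.
  move=> t' r; rewrite !lt_min => /andP[t'd _] /and3P[r0 _ rK].
  apply: (@le_trans _ _ (`|h t| + 1)).
    rewrite -(subrK (h t) (h t')) (le_trans (ler_normD _ _))// addrC lerD2l.
    exact/ltW/dP.
  by rewrite -(invrK (`|h t| + 1)) lef_pV2 ?posrE ?invr_gt0// ltW.
by exists r^-1; first by rewrite invr_gt0.
Qed.

Lemma MVT_near (f : R -> R) (u v : R) : (forall s : R, derivable f s 1) ->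
  exists2 c, `|c - u| <= `|v - u| & f v - f u = derive1 f c * (v - u).
Proof.
move=> df.
have df' (s : R) : is_derive s 1 f (derive1 f s) by rewrite derive1E; exact: DeriveDef.
have cf := is_derive_continuous df'.
have [uv|/ltW vu] := leP u v.
  have [|c] := @MVT_segment _ f (derive1 f) u v uv (fun s _ => df' s).
    exact: continuous_subspaceT.
  rewrite in_itv/= => /andP[uc cv] E; exists c => //.
  by rewrite !ger0_norm ?subr_ge0// lerD2r.
have [|c] := @MVT_segment _ f (derive1 f) v u vu (fun s _ => df' s).
  exact: continuous_subspaceT.
rewrite in_itv/= => /andP[vc cu] E; exists c.
  by rewrite !ler0_norm ?subr_le0// !opprB lerB.
by rewrite -opprB E -mulrN opprB.
Qed.

End segment_tools.

(** * The first variation *)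

Section lagrangian.
Context {R : realType}.
Notation mu := (@lebesgue_measure R).
Implicit Types (x y z h k l : R -> R).
Variables (a b : R) (L : R -> R -> R -> R -> R).
Hypothesis ab : a < b.
Hypothesis hL : C1_slab a b L.

Lemma continuous_slab_near (F : R -> R -> R -> R -> R) (t x0 y0 z0 e : R) :
  continuous_slab a b F -> t \in `[a, b] -> 0 < e ->
  exists2 r, 0 < r & forall t' (x' y' z' : R), t' \in `[a, b] ->
    `|t' - t| < r -> `|x' - x0| < r -> `|y' - y0| < r -> `|z' - z0| < r ->
    `|F t' x' y' z' - F t x0 y0 z0| < e.
Proof.
move=> /subspace_continuousP/(_ (t, x0, y0, z0)) /= cF tab e0.
have /cvgrPdist_lt/(_ _ e0)/nbhs_ballP[r /= r0 rP] := cF tab.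
exists r => // t' x' y' z' t'ab tt xx yy zz.
rewrite distrC; apply: (rP (t', x', y', z')) => //=.
by do 3?[split]; rewrite /ball/= distrC.
Qed.

Lemma continuous_slab_curve (F : R -> R -> R -> R -> R) x y z :
  continuous_slab a b F -> continuous x -> continuous y -> continuous z ->
  continuous (fun t => F (clamp a b t) (x t) (y t) (z t)).
Proof.
move=> cF cx cy cz.
pose g t := (clamp a b t, x t, y t, z t).
have cg : continuous g.
  move=> t.
  exact: (cvg_pair (cvg_pair (cvg_pair (@continuous_clamp R a b t) (cx t)) (cy t)) (cz t)).
by apply: (continuous_within_comp cF cg) => t /=; exact: clamp_itv (ltW ab).
Qed.

Lemma continuous_slab_uniform (F : R -> R -> R -> R -> R) x y z e :
  continuous_slab a b F -> continuous x -> continuous y -> continuous z ->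
  0 < e -> exists2 r, 0 < r & forall t, t \in `[a, b] -> forall x' y' z' : R,
    `|x' - x t| < r -> `|y' - y t| < r -> `|z' - z t| < r ->
    `|F t x' y' z' - F t (x t) (y t) (z t)| <= e.
Proof.
move=> cF cx cy cz e0.
suff [r r0 rP] : exists2 r, 0 < r & forall t, t \in `[a, b] ->
    t \in `[a, b] -> forall x' y' z' : R,
    `|x' - x t| < r -> `|y' - y t| < r -> `|z' - z t| < r ->
    `|F t x' y' z' - F t (x t) (y t) (z t)| <= e.
  by exists r => // t tab; exact: rP.
apply: segment_uniform => t tab.
have e2 : 0 < e / 2 by rewrite divr_gt0.
have [r r0 rP] := continuous_slab_near (x t) (y t) (z t) cF tab e2.
have r2 : 0 < r / 2 by rewrite divr_gt0.
have /continuous_atP/(_ _ r2)[dx dx0 dxP] := cx t.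
have /continuous_atP/(_ _ r2)[dy dy0 dyP] := cy t.
have /continuous_atP/(_ _ r2)[dz dz0 dzP] := cz t.
exists (Num.min (Num.min (r / 2) dx) (Num.min dy dz)).
  by rewrite !lt_min r2 dx0 dy0.
move=> t' r'; rewrite !lt_min => /andP[/andP[t'r t'x] /andP[t'y t'z]].
move=> /andP[r'0 /andP[/andP[r'r _] _]] t'ab x' y' z' x'x y'y z'z.
have near (u : R -> R) (u' : R) : `|u t' - u t| < r / 2 -> `|u' - u t'| < r' -> `|u' - u t| < r.
  move=> h1 h2; rewrite -(subrK (u t') u') -addrA (le_lt_trans (ler_normD _ _))//.
  by rewrite (splitr r) ltrD// (lt_trans h2).
have rr : r / 2 < r by rewrite ltr_pdivrMr// ltr_pMr// ltr1n.
have h1 : `|F t' x' y' z' - F t (x t) (y t) (z t)| < e / 2.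
  apply: rP => //; first exact: lt_trans rr.
  - exact: near (dxP _ t'x) x'x.
  - exact: near (dyP _ t'y) y'y.
  - exact: near (dzP _ t'z) z'z.
have h2 : `|F t' (x t') (y t') (z t') - F t (x t) (y t) (z t)| < e / 2.
  apply: rP => //; first exact: lt_trans rr.
  - exact: lt_trans (dxP _ t'x) rr.
  - exact: lt_trans (dyP _ t'y) rr.
  - exact: lt_trans (dzP _ t'z) rr.
rewrite -(subrK (F t (x t) (y t) (z t)) (F t' x' y' z')) -addrA.
rewrite (le_trans (ler_normD _ _))// (splitr e) lerD// ltW//.
by rewrite distrC.
Qed.

(** The mean value theorem in one argument at a time; the three intermediate
points stay close to the curve, where the partial derivatives are uniformly
continuous. *)
Lemma lagrangian_expansion x y z e :
  continuous x -> continuous y -> continuous z -> 0 < e ->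
  exists2 r, 0 < r & forall t, t \in `[a, b] -> forall u v s,
    `|u| < r -> `|v| < r -> `|s| < r ->
    `|L t (x t + u) (y t + v) (z t + s) - L t (x t) (y t) (z t) -
      (partial2 L t (x t) (y t) (z t) * u + partial3 L t (x t) (y t) (z t) * v +
       partial4 L t (x t) (y t) (z t) * s)| <= e * (`|u| + `|v| + `|s|).
Proof.
move: hL => [dL [_ c2 c3 c4]] cx cy cz e0.
have [r2 r20 r2P] := continuous_slab_uniform c2 cx cy cz e0.
have [r3 r30 r3P] := continuous_slab_uniform c3 cx cy cz e0.
have [r4 r40 r4P] := continuous_slab_uniform c4 cx cy cz e0.
exists (Num.min r2 (Num.min r3 r4)); first by rewrite !lt_min r20 r30.
move=> t tab u v s; rewrite !lt_min => /and3P[u2 u3 u4] /and3P[v2 v3 v4] /and3P[s2 s3 s4].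
have [c2' c2u E2] := @MVT_near R (fun p => L t p (y t + v) (z t + s)) (x t) (x t + u)
  (fun p => let: And4 _ h _ _ := dL t p (y t + v) (z t + s) tab in h).
have [c3' c3v E3] := @MVT_near R (fun p => L t (x t) p (z t + s)) (y t) (y t + v)
  (fun p => let: And4 _ _ h _ := dL t (x t) p (z t + s) tab in h).
have [c4' c4s E4] := @MVT_near R (fun p => L t (x t) (y t) p) (z t) (z t + s)
  (fun p => let: And4 _ _ _ h := dL t (x t) (y t) p tab in h).
have K (p p' : R) : p + p' - p = p' by rewrite addrAC subrr add0r.
rewrite !K in c2u c3v c4s E2 E3 E4.
have D2 := r2P t tab c2' (y t + v) (z t + s) (le_lt_trans c2u u2).
rewrite !K in D2; have {}D2 := D2 v2 s2.
have D3 := r3P t tab (x t) c3' (z t + s).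
rewrite subrr normr0 !K in D3; have {}D3 := D3 r30 (le_lt_trans c3v v3) s3.
have D4 := r4P t tab (x t) (y t) c4'.
rewrite !subrr !normr0 in D4; have {}D4 := D4 r40 r40 (le_lt_trans c4s s4).
have -> : L t (x t + u) (y t + v) (z t + s) - L t (x t) (y t) (z t) =
  derive1 (fun p => L t p (y t + v) (z t + s)) c2' * u +
  derive1 (fun p => L t (x t) p (z t + s)) c3' * v +
  derive1 (fun p => L t (x t) (y t) p) c4' * s.
  by rewrite -E2 -E3 -E4; ring.
have -> (A A' P Q S P' Q' S' : R) : P * A + Q * A' + S * s -
  (P' * A + Q' * A' + S' * s) = (P - P') * A + (Q - Q') * A' + (S - S') * s by ring.
rewrite !mulrDr; apply: (le_trans (ler_normD _ _)); apply: lerD.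
  apply: (le_trans (ler_normD _ _)); rewrite !normrM.
  by apply: lerD; [exact: ler_wpM2r D2|exact: ler_wpM2r D3].
by rewrite normrM; exact: ler_wpM2r D4.
Qed.

(** Joint continuity of [L] is not among the hypotheses. Near the point of the
curve at [t] it follows from the expansion around the constant curve, [L]
being continuous in its first argument by differentiability. *)
Lemma continuous_lagrangian x y z :
  continuous x -> continuous y -> continuous z ->
  continuous (fun t => L (clamp a b t) (x t) (y t) (z t)).
Proof.
move=> cx cy cz t; move: (hL) => [dL [_ c2 c3 c4]].
have [r r0 rP] := lagrangian_expansion (@continuous_const R (x t))
  (@continuous_const R (y t)) (@continuous_const R (z t)) ltr01.
pose G s := L (clamp a b s) (x t) (y t) (z t) +
  (partial2 L (clamp a b s) (x t) (y t) (z t) * (x s - x t) +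
   partial3 L (clamp a b s) (x t) (y t) (z t) * (y s - y t) +
   partial4 L (clamp a b s) (x t) (y t) (z t) * (z s - z t)).
have cP F : continuous_slab a b F ->
    continuous (fun s => F (clamp a b s) (x t) (y t) (z t)).
  by move=> cF; apply: continuous_slab_curve => //; exact: continuous_const.
have cB (u : R -> R) : continuous u -> continuous (fun s => u s - u t).
  by move=> cu; apply: continuous_fsub => //; exact: continuous_const.
have cG : continuous G.
  move=> s; apply: cvgD.
    have cL : {within `[a, b], continuous (fun s => L s (x t) (y t) (z t))}.
      apply: derivable_in_continuous => p pab.
      by have [dp _ _ _] := dL p (x t) (y t) (z t) pab; exact: dp.
    exact: (continuous_clamp_comp (ltW ab) cL).
  apply: cvgD; [apply: cvgD|].
  - exact: (continuous_fmul (cP _ c2) (cB _ cx)).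
  - exact: (continuous_fmul (cP _ c3) (cB _ cy)).
  - exact: (continuous_fmul (cP _ c4) (cB _ cz)).
apply/continuous_atP => e e0.
have e4 : 0 < e / 4 by rewrite divr_gt0.
have m0 : 0 < Num.min r (e / 4) by rewrite lt_min r0.
have /continuous_atP/(_ _ m0)[dx dx0 dxP] := cx t.
have /continuous_atP/(_ _ m0)[dy dy0 dyP] := cy t.
have /continuous_atP/(_ _ m0)[dz dz0 dzP] := cz t.
have /continuous_atP/(_ _ e4)[dg dg0 dgP] := cG t.
exists (Num.min (Num.min dx dy) (Num.min dz dg)).
  by rewrite !lt_min dx0 dy0 dz0.
move=> s; rewrite !lt_min => /andP[/andP[sx sy] /andP[sz sg]].
have := dxP _ sx; have := dyP _ sy; have := dzP _ sz; rewrite !lt_min.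
move=> /andP[z1 z2] /andP[y1 y2] /andP[x1 x2]; have g1 := dgP _ sg.
have sab := clamp_itv s (ltW ab).
have := rP _ sab (x s - x t) (y s - y t) (z s - z t) x1 y1 z1.
have S (p p' : R) : p' + (p - p') = p by rewrite addrC subrK.
rewrite !S => est.
have Gt : L (clamp a b t) (x t) (y t) (z t) = G t.
  by rewrite /G !subrr !mulr0 !addr0.
set A := L (clamp a b s) (x s) (y s) (z s).
have -> : A - L (clamp a b t) (x t) (y t) (z t) = (A - G s) + (G s - G t).
  by rewrite Gt; ring.
have AG : `|A - G s| <= `|x s - x t| + `|y s - y t| + `|z s - z t|.
  by rewrite /G opprD addrA -[leRHS]mul1r.
rewrite (le_lt_trans (ler_normD _ _))//; lra.
Qed.

Definition lagrangian_variation x y z h k l (t : R) : R :=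
  partial2 L t (x t) (y t) (z t) * h t + partial3 L t (x t) (y t) (z t) * k t +
  partial4 L t (x t) (y t) (z t) * l t.

(** The error is small relative to [`|c|] at one scale [`|c| = d], for both signs of
[c]; nothing more is needed to find the derivative at a minimum. *)
Lemma energy_expansion x y z h k l e :
  continuous x -> continuous y -> continuous z ->
  continuous h -> continuous k -> continuous l -> 0 < e ->
  exists2 d, 0 < d & forall c, `|c| = d ->
    \int[mu]_(t in `[a, b]) L t (x t + c * h t) (y t + c * k t) (z t + c * l t) <=
    \int[mu]_(t in `[a, b]) L t (x t) (y t) (z t) +
    c * \int[mu]_(t in `[a, b]) lagrangian_variation x y z h k l t + d * e.
Proof.
move=> cx cy cz ch ck cl e0; move: (hL) => [_ [_ c2 c3 c4]].
pose m t := partial2 L (clamp a b t) (x t) (y t) (z t) * h t +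
     partial3 L (clamp a b t) (x t) (y t) (z t) * k t +
     partial4 L (clamp a b t) (x t) (y t) (z t) * l t.
have cm : continuous m.
  move=> t; apply: cvgD; [apply: cvgD|].
  - exact: (continuous_fmul (continuous_slab_curve c2 cx cy cz) ch).
  - exact: (continuous_fmul (continuous_slab_curve c3 cx cy cz) ck).
  - exact: (continuous_fmul (continuous_slab_curve c4 cx cy cz) cl).
pose n t := `|h t| + `|k t| + `|l t|.
have cn : continuous n.
  move=> t; apply: cvgD; [apply: cvgD|]; apply: cvg_norm;
    by [exact: ch|exact: ck|exact: cl].
pose N := \int[mu]_(t in `[a, b]) n t.
have N0 : 0 <= N by apply: Rintegral_ge0 => t _; rewrite !addr_ge0.
pose eta := e / (N + 1).
have eta0 : 0 < eta by rewrite divr_gt0// ltr_wpDl.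
have etaN : eta * N <= e by exact: ltW (divD1_mulr_lt e0 N0).
have [K1 K10 K1P] := segment_bounded a b ch.
have [K2 K20 K2P] := segment_bounded a b ck.
have [K3 K30 K3P] := segment_bounded a b cl.
pose K := K1 + K2 + K3; have K0 : 0 < K by rewrite !addr_gt0.
have [K1K K2K K3K] : [/\ K1 <= K, K2 <= K & K3 <= K].
  by rewrite /K; split; clear -K10 K20 K30; lra.
have [r r0 rP] := lagrangian_expansion cx cy cz eta0.
pose d := r / (K + 1).
have d0 : 0 < d by rewrite divr_gt0// addr_gt0.
have dK : d * K < r by exact: divD1_mulr_lt r0 (ltW K0).
exists d => // c cd.
pose l1 t := L (clamp a b t) (x t + c * h t) (y t + c * k t) (z t + c * l t).
pose l0 t := L (clamp a b t) (x t) (y t) (z t).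
have cadd (u v : R -> R) : continuous u -> continuous v -> continuous (fun t => u t + c * v t).
  move=> cu cv t; apply: cvgD; first exact: cu.
  by apply: cvgM; [exact: cvg_cst|exact: cv].
have cl1 : continuous l1 := continuous_lagrangian (cadd _ _ cx ch) (cadd _ _ cy ck) (cadd _ _ cz cl).
have cl0 : continuous l0 := continuous_lagrangian cx cy cz.
have toClamp (F G : R -> R) : {in `[a, b], F =1 G} ->
    \int[mu]_(t in `[a, b]) F t = \int[mu]_(t in `[a, b]) G t.
  by move=> FG; apply: eq_Rintegral => t; rewrite inE/= => tab; exact: FG.
rewrite (toClamp (fun t => L t _ _ _) l1); last first.
  by move=> t tab; rewrite /l1 clamp_id.
rewrite (toClamp (fun t => L t (x t) (y t) (z t)) l0); last first.
  by move=> t tab; rewrite /l0 clamp_id.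
rewrite (toClamp (lagrangian_variation x y z h k l) m); last first.
  by move=> t tab; rewrite /m /lagrangian_variation clamp_id.
apply: (@le_trans _ _ (\int[mu]_(t in `[a, b]) l0 t +
    c * \int[mu]_(t in `[a, b]) m t + d * (eta * N))); last first.
  by rewrite lerD2l ler_pM2l.
rewrite mulrA -[X in X + _ * _ + _]mul1r.
rewrite -(Rintegral_linear 1 c a b cl0 cm).
have cl0m := @continuous_linear R l0 m 1 c cl0 cm.
rewrite -[X in X + _ * N]mul1r.
rewrite -(Rintegral_linear 1 (d * eta) a b cl0m cn).
apply: Rintegral_mono cl1 (@continuous_linear R _ n 1 (d * eta) cl0m cn) _ => t tab.
have small (u : R -> R) Ku : (forall t, t \in `[a, b] -> `|u t| <= Ku) ->
    Ku <= K -> `|c * u t| < r.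
  move=> uK KuK; apply: le_lt_trans dK; rewrite normrM cd.
  by rewrite (ler_pM2l d0); exact: le_trans (uK _ tab) KuK.
have := rP _ tab _ _ _ (small h K1 K1P K1K) (small k K2 K2P K2K) (small l K3 K3P K3K).
rewrite !normrM cd -!mulrDr -/(n t) /l1 /l0 /m clamp_id// => /ler_normlP[_].
set p2 := partial2 _ _ _ _ _; set p3 := partial3 _ _ _ _ _.
set p4 := partial4 _ _ _ _ _; set l1t := L _ (_ + _) _ _; set l0t := L _ _ _ _.
have -> : p2 * (c * h t) + p3 * (c * k t) + p4 * (c * l t) =
   c * (p2 * h t + p3 * k t + p4 * l t) by ring.
rewrite lerBlDr lerBlDr => /le_trans; apply.
by rewrite le_eqVlt; apply/orP; left; apply/eqP; ring.
Qed.

Lemma first_variation x y z h k l :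
  continuous x -> continuous y -> continuous z ->
  continuous h -> continuous k -> continuous l ->
  (forall c, \int[mu]_(t in `[a, b]) L t (x t) (y t) (z t) <=
    \int[mu]_(t in `[a, b]) L t (x t + c * h t) (y t + c * k t) (z t + c * l t)) ->
  \int[mu]_(t in `[a, b]) lagrangian_variation x y z h k l t = 0.
Proof.
move=> cx cy cz ch ck cl Jmin; set I := \int[mu]_(t in _) _.
apply/eqP; rewrite -normr_le0; apply/ler_addgt0Pr => e e0; rewrite add0r.
have [d d0 dP] := energy_expansion cx cy cz ch ck cl e0.
have bound c : `|c| = d -> 0 <= c * I + d * e.
  by move=> /dP /(le_trans (Jmin c)); rewrite -addrA lerDl.
have := bound d (gtr0_norm d0); rewrite -mulrDr pmulr_rge0// => B1.
have := bound (- d); rewrite normrN => /(_ (gtr0_norm d0)).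
rewrite mulNr -mulrN -mulrDr pmulr_rge0// => B2.
rewrite ler_norml; apply/andP; split.
  by rewrite -subr_ge0 opprK.
by rewrite -subr_ge0 addrC.
Qed.

End lagrangian.

Section fundamental_lemma.
Context {R : realType}.
Notation mu := (@lebesgue_measure R).

(** If [phi t] were nonzero, [phi] would keep its sign on a subinterval of
`[a, b] next to [t]; a tent supported there contradicts the hypothesis. Taking
the intersection of a neighbourhood of [t] with the segment treats the
endpoints like the interior points. *)
Lemma fundamental_lemma (a b : R) (phi : R -> R) : a < b -> continuous phi ->
  (forall h, (forall s t, `|h s - h t| <= `|s - t|) -> h a = 0 -> h b = 0 ->
    \int[mu]_(t in `[a, b]) (h t * phi t) = 0) ->
  forall t, t \in `[a, b] -> phi t = 0.
Proof.
move=> ab cphi H t; rewrite in_itv/= => /andP[ta tb]; apply/eqP/negPn/negP => phi0.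
have n0 : 0 < `|phi t| by rewrite normr_gt0.
have /continuous_atP/(_ _ n0)[r r0 rP] := cphi t.
pose c := Num.max a (t - r); pose d := Num.min b (t + r).
have ac : a <= c by rewrite le_max lexx.
have rc : t - r <= c by rewrite le_max lexx orbT.
have db : d <= b by rewrite ge_min lexx.
have dr : d <= t + r by rewrite ge_min lexx orbT.
have cd : c < d.
  by rewrite /c /d lt_min !gt_max; apply/andP; split; apply/andP; split; lra.
pose m := (c + d) / 2; pose q := (d - c) / 2.
have q0 : 0 < q by rewrite /q divr_gt0// subr_gt0.
pose h s : R := Num.max 0 (q - `|s - m|).
have hlip s s' : `|h s - h s'| <= `|s - s'|.
  have K : `| `|s' - m| - `|s - m| | <= `|s - s'|.
    rewrite (le_trans (ler_dist_dist _ _))// le_eqVlt; apply/orP; left.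
    by rewrite [eqbRHS]distrC; apply/eqP; congr (`|_|); ring.
  apply: le_trans K; rewrite /h.
  set p := `|s - m|; set p' := `|s' - m|.
  by case: (leP 0 (q - p)) => ?; case: (leP 0 (q - p')) => ?;
    rewrite ler_norml; have := ler_norm (p' - p); have := ler_norm (- (p' - p));
    rewrite normrN => ? ?; apply/andP; split; lra.
have hout s : q <= `|s - m| -> h s = 0.
  by move=> qs; rewrite /h (max_idPl _)// subr_le0.
have ha : h a = 0.
  by apply: hout; rewrite distrC; apply: le_trans (ler_norm _); rewrite /m /q; lra.
have hb : h b = 0.
  by apply: hout; apply: le_trans (ler_norm _); rewrite /m /q; lra.
have ch : continuous h.
  move=> s; apply/continuous_atP => e e0; exists e => // s' ss'.
  exact: le_lt_trans (hlip _ _) ss'.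
have pos s : `|s - m| < q -> 0 < phi t * phi s.
  move=> /ltr_normlP[s1 s2].
  have : `|phi s - phi t| < `|phi t|.
    by apply: rP; apply/ltr_normlP; move: s1 s2; rewrite /m /q => *; split; lra.
  have [pt|pt|pt] := ltgtP (phi t) 0; last by rewrite pt eqxx in phi0.
    rewrite (ltr0_norm pt) => /ltr_normlP[_ ?]; rewrite nmulr_rgt0//; lra.
  by rewrite (gtr0_norm pt) => /ltr_normlP[? _]; rewrite pmulr_rgt0//; lra.
pose f s := phi t * (h s * phi s).
have cf : continuous f.
  apply: continuous_fmul; first exact: continuous_const.
  exact: continuous_fmul.
have f0 s : s \in `[a, b] -> 0 <= f s.
  move=> _; rewrite /f; have [sq|qs] := ltP `|s - m| q.
    rewrite mulrCA mulr_ge0//; first by rewrite /h le_max lexx.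
    exact/ltW/pos.
  by rewrite hout// mul0r mulr0.
have fi : \int[mu]_(s in `[a, b]) f s = 0.
  rewrite /f RintegralZl//; last first.
    by apply: continuous_integrable; exact: continuous_fmul.
  by rewrite H// mulr0.
have mab : m \in `]a, b[ by rewrite in_itv/= /m; apply/andP; split; lra.
have := Rintegral_eq0_continuous ab cf f0 fi mab.
have pm : 0 < phi t * phi m by apply: pos; rewrite subrr normr0.
rewrite /f mulrCA /h subrr normr0 subr0 (max_idPr (ltW q0)) => /eqP.
by rewrite gt_eqF// mulr_gt0.
Qed.

End fundamental_lemma.

(** * The Euler-Lagrange equation *)

Section admissible_variations.
Context {R : realType}.

Lemma abs_continuous_within (a b : R) (f : R -> R) : abs_continuous a b f ->
  {within `[a, b], continuous f}.
Proof.
move=> acf; apply/subspace_continuousP => t tab.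
apply/cvgrPdist_lt => e e0; have [d d0 dP] := acf e e0.
apply/nbhs_ballP; exists d => //= s; rewrite /ball/= => st sab.
have tri (u v : 'I_1 -> R) : trivIset setT (fun i => [set` `]u i, v i[ ]).
  by move=> i j _ _ _; rewrite !ord1.
move: tab sab; rewrite /= !in_itv/= => /andP[ta tb] /andP[sa sb].
have [ts|/ltW ts] := leP t s.
  have := dP 1%N (fun=> t) (fun=> s) (fun=> And3 ta ts sb) (tri _ _).
  rewrite !big_ord1 distrC => H; apply: H; apply: le_lt_trans st.
  by rewrite distrC ler_norm.
have := dP 1%N (fun=> s) (fun=> t) (fun=> And3 sa ts tb) (tri _ _).
by rewrite !big_ord1 => H; apply: H; apply: le_lt_trans st; rewrite ler_norm.
Qed.

Lemma abs_continuous_lipschitzD (a b c : R) (f h : R -> R) :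
  abs_continuous a b f -> (forall s t, `|h s - h t| <= `|s - t|) ->
  abs_continuous a b (fun t => f t + c * h t).
Proof.
move=> acf hlip e e0; have e2 : 0 < e / 2 by rewrite divr_gt0.
have c0 : 0 < `|c| + 1 by rewrite ltr_wpDl.
have [d d0 dP] := acf _ e2.
exists (Num.min d (e / 2 / (`|c| + 1))); first by rewrite lt_min d0 divr_gt0.
move=> n u v uv tri; rewrite lt_min => /andP[sd sc].
apply: (@le_lt_trans _ _ (\sum_(i < n) (`|f (v i) - f (u i)| +
    (`|c| + 1) * (v i - u i)))).
  apply: ler_sum => i _; have [_ uvi _] := uv i.
  have -> : f (v i) + c * h (v i) - (f (u i) + c * h (u i)) =
    (f (v i) - f (u i)) + c * (h (v i) - h (u i)) by ring.
  apply: le_trans (ler_normD _ _) _; rewrite lerD2l normrM.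
  have vu0 : 0 <= v i - u i by rewrite subr_ge0.
  apply: ler_pM => //; first by rewrite lerDl.
  by rewrite -[leRHS]ger0_norm.
rewrite big_split/= -mulr_sumr (splitr e); apply: ltrD; first exact: dP.
by rewrite mulrC -ltr_pdivlMr.
Qed.

Lemma continuous_inv (f : R -> R) : continuous f -> (forall t, f t != 0) ->
  continuous (fun t => (f t)^-1).
Proof. by move=> cf f0 t; apply: cvgV; [exact: f0|exact: cf]. Qed.

End admissible_variations.

Theorem theorem5 (R : realType) (a b : R) (B : R -> R) (alpha beta : R)
    (w : R -> R) (L : R -> R -> R -> R -> R) (Xa Xb : R) (X : R -> R)
    (hab : a < b)
    (halpha0 : 0 <= alpha) (halpha1 : alpha < 1) (hbeta : 0 < beta)
    (hB0 : B 0 = 1) (hB1 : B 1 = 1) (hBalpha : B alpha <> 0)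
    (hwC1 : C1_in `[a, b] w)
    (hw : forall t, t \in `[a, b] -> 0 < w t)
    (hw' : forall t, t \in `[a, b] -> 0 < deriv_in `[a, b] w t)
    (hL : C1_slab a b L)
    (hX : minimizer a b B alpha beta w L Xa Xb X) :
  let g3 := fun s => along a b B alpha beta w (partial3 L) X s / w s ^+ 2 in
  let g4 := fun s => along a b B alpha beta w (partial4 L) X s / w s ^+ 2 in
  forall t, t \in `[a, b] ->
    [/\ wRD_right_exists a b alpha beta w g3 t,
        wRD_left_exists a b alpha beta w g4 t &
        along a b B alpha beta w (partial2 L) X t
          + w t ^+ 2 * wRD_right a b B alpha beta w g3 t
          + w t ^+ 2 * wRD_left a b B alpha beta w g4 t = 0].
Proof.
(* all functions of [t] are precomposed with the projection onto `[a, b], which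
   makes them continuous on the line and changes no integral over `[a, b] *)
move=> g3 g4; have abW := ltW hab; have [_ [_ c2 c3 c4]] := hL.
have T0 : 0 <= b - a by rewrite subr_ge0.
have [q [tq q0 qs]] := frac_kernel_split T0 halpha0 halpha1 hbeta.
have [[acX _] Xa_ Xb_] := proj1 hX.
pose wc := w \o clamp a b.
have cw : continuous wc.
  apply: (continuous_clamp_comp abW).
  exact: (derivable_in_continuous (proj1 hwC1)).
have w0 t : wc t != 0 by rewrite gt_eqF// hw// clamp_itv.
have cww : continuous (fun t => wc t ^+ 2) := continuous_fmul cw cw.
have cwV := continuous_inv cw w0.
have cwext f : continuous (f \o clamp a b) -> continuous (wext a b w f).
  by move=> cf; exact: (continuous_fmul cw cf).
pose lft f t := wRD_left a b B alpha beta w f (clamp a b t).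
pose rgt f t := wRD_right a b B alpha beta w f (clamp a b t).
have clamp2 f t : wext a b w f (clamp a b t) = wext a b w f t.
  by rewrite /wext/= (clamp_id (clamp_itv t abW)).
have clft f : continuous (wext a b w f) -> continuous (lft f).
  move=> cf; have cd := continuous_dconvol tq cf abW.
  have -> : lft f = (fun t => 1 / frac_phi B alpha * (1 / wc t) *
      (frac_kernel alpha beta 0 * wext a b w f t + dconvol a b q (wext a b w f) (clamp a b t))).
    apply/funext => t; rewrite /lft.
    by rewrite (proj2 (wRD_left_spec B hab tq q0 qs cf (clamp_itv t abW))) clamp2.
  move=> t; apply: cvgM; last first.
    apply: cvgD.
      by apply: cvgM; [exact: cvg_cst|exact: cf].
    by apply: continuous_comp; [exact: continuous_clamp|exact: cd].
  apply: cvgM; first exact: cvg_cst.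
  by apply: cvgM; [exact: cvg_cst|exact: cwV].
have crgt f : continuous (wext a b w f) -> continuous (rgt f).
  move=> cf; have cd := continuous_dconvol (tame_kernelN tq) cf abW.
  have -> : rgt f = (fun t => - 1 / frac_phi B alpha * (1 / wc t) *
      (- (frac_kernel alpha beta 0 * wext a b w f t) + dconvol a b (q \o -%R) (wext a b w f) (clamp a b t))).
    apply/funext => t; rewrite /rgt.
    by rewrite (proj2 (wRD_right_spec B hab tq q0 qs cf (clamp_itv t abW))) clamp2.
  move=> t; apply: cvgM; last first.
    apply: cvgD.
      by apply: cvgN; apply: cvgM; [exact: cvg_cst|exact: cf].
    by apply: continuous_comp; [exact: continuous_clamp|exact: cd].
  apply: cvgM; first exact: cvg_cst.
  by apply: cvgM; [exact: cvg_cst|exact: cwV].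
pose x := X \o clamp a b.
have cx : continuous x := continuous_clamp_comp abW (abs_continuous_within acX).
have cX := cwext X cx; have cy := clft X cX; have cz := crgt X cX.
pose p F t : R := along a b B alpha beta w F X (clamp a b t).
have cp F : continuous_slab a b F -> continuous (p F).
  by move=> cF; exact: (continuous_slab_curve hab cF cx cy cz).
have cg F : continuous_slab a b F ->
    continuous (wext a b w (fun s => along a b B alpha beta w F X s / w s ^+ 2)).
  move=> cF; apply: (continuous_fmul cw); apply: (continuous_fmul (cp F cF)).
  exact: (continuous_inv cww (fun t => expf_neq0 2 (w0 t))).
have cg3 : continuous (wext a b w g3) := cg _ c3.
have cg4 : continuous (wext a b w g4) := cg _ c4.
pose EL t := along a b B alpha beta w (partial2 L) X t
          + w t ^+ 2 * wRD_right a b B alpha beta w g3 t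
          + w t ^+ 2 * wRD_left a b B alpha beta w g4 t.
have cEL : continuous (EL \o clamp a b).
  move=> t; apply: cvgD; first apply: cvgD.
  - exact: (cp _ c2).
  - exact: (continuous_fmul cww (crgt _ cg3)).
  - exact: (continuous_fmul cww (clft _ cg4)).
have EL0 : forall t, t \in `[a, b] -> (EL \o clamp a b) t = 0.
  apply: (fundamental_lemma hab cEL) => h hlip ha hb.
  have ch : continuous h.
    move=> s; apply/continuous_atP => e e0; exists e => // s' ss'.
    exact: le_lt_trans (hlip _ _) ss'.
  have cH : continuous (wext a b w h).
    by apply: cwext => t; apply: continuous_comp; [exact: continuous_clamp|exact: ch].
  have var0 : \int[lebesgue_measure]_(t in `[a, b])
      lagrangian_variation L x (lft X) (rgt X) h (lft h) (rgt h) t = 0.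
    apply: (first_variation hab hL cx cy cz ch (clft h cH) (crgt h cH)) => c.
    pose Y t := X t + c * h t.
    have cY : continuous (wext a b w Y).
      rewrite /Y wext_linear => t; apply: cvgD; first exact: cX.
      by apply: cvgM; [exact: cvg_cst|exact: cH].
    have admY : admissible a b alpha beta w Xa Xb Y.
      split; last 2 first.
      - by rewrite /Y ha mulr0 addr0.
      - by rewrite /Y hb mulr0 addr0.
      split; first exact: abs_continuous_lipschitzD acX hlip.
      move=> t tab; split.
        exact: proj1 (wRD_left_spec B hab tq q0 qs cY tab).
      exact: proj1 (wRD_right_spec B hab tq q0 qs cY tab).
    have JX : frac_J a b B alpha beta w L X =
        \int[lebesgue_measure]_(t in `[a, b]) L t (x t) (lft X t) (rgt X t).
      apply: eq_Rintegral => t; rewrite inE/= => tab.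
      by rewrite /along /x /lft /rgt /= (clamp_id tab).
    have JY : frac_J a b B alpha beta w L Y =
        \int[lebesgue_measure]_(t in `[a, b])
          L t (x t + c * h t) (lft X t + c * lft h t) (rgt X t + c * rgt h t).
      apply: eq_Rintegral => t; rewrite inE/= => tab.
      rewrite /along /x /lft /rgt /= (clamp_id tab).
      by have [-> ->] := wRD_linear B hab tq q0 qs c cX cH tab.
    by rewrite -JX -JY; exact: (proj2 hX).
  (* move the fractional derivatives from [h] to the partial derivatives of [L] *)
  have [A3 _] := wRD_adjoint B hab tq q0 qs hw cg3 cH.
  have [_ A4] := wRD_adjoint B hab tq q0 qs hw cg4 cH.
  pose u2 t := p (partial2 L) t * h t.
  pose u3 t := h t * (wc t ^+ 2 * rgt g3 t).
  pose u4 t := h t * (wc t ^+ 2 * lft g4 t).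
  pose v3 t := p (partial3 L) t * lft h t.
  pose v4 t := p (partial4 L) t * rgt h t.
  have cu2 : continuous u2 := continuous_fmul (cp _ c2) ch.
  have cu3 : continuous u3 := continuous_fmul ch (continuous_fmul cww (crgt _ cg3)).
  have cu4 : continuous u4 := continuous_fmul ch (continuous_fmul cww (clft _ cg4)).
  have cv3 : continuous v3 := continuous_fmul (cp _ c3) (clft _ cH).
  have cv4 : continuous v4 := continuous_fmul (cp _ c4) (crgt _ cH).
  have uv3 : \int[lebesgue_measure]_(t in `[a, b]) u3 t =
      \int[lebesgue_measure]_(t in `[a, b]) v3 t.
    transitivity (\int[lebesgue_measure]_(t in `[a, b]) (h t * (w t ^+ 2 *
        wRD_right a b B alpha beta w g3 t))).
      apply: eq_Rintegral => t; rewrite inE/= => tab.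
      by rewrite /u3 /rgt /wc /= (clamp_id tab).
    rewrite -A3; apply: eq_Rintegral => t; rewrite inE/= => tab.
    by rewrite /v3 /p /lft (clamp_id tab).
  have uv4 : \int[lebesgue_measure]_(t in `[a, b]) u4 t =
      \int[lebesgue_measure]_(t in `[a, b]) v4 t.
    transitivity (\int[lebesgue_measure]_(t in `[a, b]) (h t * (w t ^+ 2 *
        wRD_left a b B alpha beta w g4 t))).
      apply: eq_Rintegral => t; rewrite inE/= => tab.
      by rewrite /u4 /lft /wc /= (clamp_id tab).
    rewrite -A4; apply: eq_Rintegral => t; rewrite inE/= => tab.
    by rewrite /v4 /p /rgt (clamp_id tab).
  have add3 (u v z : R -> R) : continuous u -> continuous v -> continuous z ->
      \int[lebesgue_measure]_(t in `[a, b]) (u t + v t + z t) =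
      \int[lebesgue_measure]_(t in `[a, b]) u t +
      \int[lebesgue_measure]_(t in `[a, b]) v t +
      \int[lebesgue_measure]_(t in `[a, b]) z t.
    move=> cu cv cz'; under eq_Rintegral => t _ do
      rewrite -[u t]mul1r -[v t]mul1r -[z t]mul1r -[_ + 1 * v t]mul1r.
    rewrite (Rintegral_linear 1 1 a b (continuous_linear cu cv) cz').
    by rewrite (Rintegral_linear 1 1 a b cu cv) !mul1r.
  rewrite (@eq_Rintegral _ _ _ lebesgue_measure _
    (fun t => u2 t + u3 t + u4 t)); last first.
    by move=> t _; rewrite /u2 /u3 /u4 /EL /p /rgt /lft /wc /=; ring.
  apply: (etrans (add3 _ _ _ cu2 cu3 cu4)).
  apply: (etrans (congr2 +%R (congr2 +%R erefl uv3) uv4)).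
  apply: (etrans (esym (add3 _ _ _ cu2 cv3 cv4))); apply: etrans var0.
  apply: eq_Rintegral => t; rewrite inE/= => tab.
  rewrite /lagrangian_variation /u2 /v3 /v4 /p /along /x /lft /rgt /=.
  by rewrite (clamp_id tab).
move=> t tab; split.
- exact: proj1 (wRD_right_spec B hab tq q0 qs cg3 tab).
- exact: proj1 (wRD_left_spec B hab tq q0 qs cg4 tab).
- by have := EL0 t tab; rewrite /= (clamp_id tab).
Qed.
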